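(* Let $q\in(0,1]$ be fixed and let $p=p_n$, $R=R_n$, $\tau=\tau_n$ be sequences; put $$\tilde\tau=\min\{c_UR^{2/q},\tau\},\qquad \tilde R=\min\{p^{1-q/2}c_L^{-q/2}\tau^{q/2},R\}.$$ Assume $\tilde R(1+\tilde\tau)^{-q/2}\big(\frac{\log p}{n}\big)^{1-q/2}=o(1)$. (a) If $1\lesssim\tilde R(1+\tilde\tau)^{-q/2}\big(\frac{\log p}{n}\big)^{-q/2}\lesssim p^{1-\delta}$ for some constant $\delta>0$, then $$\inf_{\hat\alpha}\sup_{(\mu,\Sigma)\in\mathcal H_q(R,\tau)}\mathbb E\|\hat\alpha-\alpha\|_2^2\gtrsim\min\Big\{\tilde\tau,\ (1+\tilde\tau)^{1-\frac q2}\tilde R\Big(\frac{\log p}{n}\Big)^{1-\frac q2}\Big\}.$$ (b) If $1\lesssim\tilde R^2(1+\tilde\tau)^{-q}\big(\frac{\log p}{n}\big)^{-q}\lesssim p^{1-\delta}$ for some constant $\delta>0$, then $$\inf_{\hat\theta}\sup_{(\mu,\Sigma)\in\mathcal H_q(R,\tau)}\mathbb E|\hat\theta-\theta|\gtrsim\min\Big\{\tilde\tau,\ (1+\tilde\tau)^{1-\frac q2}\tilde R\Big(\frac{\log p}{n}\Big)^{1-\frac q2}\Big\}+\min\Big\{\tilde\tau,\ \frac{\tilde\tau+\sqrt{\tilde\tau}}{\sqrt n}\Big\}.$$ The infima are over all measurable estimators (functions of $x_1,\dots,x_n$).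
   Context: Model: $x_1,\dots,x_n\in\mathbb R^p$ are i.i.d. copies of $x=\Sigma^{1/2}y+\mu$, where $\mu\in\mathbb R^p$, $\Sigma$ is a symmetric positive definite $p\times p$ matrix, and $y\in\mathbb R^p$ is zero-mean and isotropic ($\mathbb E yy^T=I_p$) and satisfies $\mathbb P(|b^Ty|\ge t)\le 2\exp(-t^2/\nu^2)$ for all $t\ge0$ and all $\|b\|_2=1$, with $\nu>0$ a fixed constant. Put $\alpha=\Sigma^{-1}\mu$, $\theta=\mu^T\Sigma^{-1}\mu$. Suprema over $(\mu,\Sigma)$ are understood to be also over all such distributions of $y$, and $\nu$ is large enough (e.g. $\nu\ge\sqrt2$) that $y\sim N(0,I_p)$ is included. Parameter space: with fixed constants $0<c_L<c_U$ and $R,\tau>0$, $$\mathcal H_q(R,\tau)=\{(\mu,\Sigma):\|\Sigma^{-1}\mu\|_q^q\le R,\ \mu^T\Sigma^{-1}\mu\le\tau,\ c_L\le\lambda_{\min}(\Sigma)\le\delta_\Sigma\le c_U\},$$ with $\|a\|_q=(\sum_i|a_i|^q)^{1/q}$ and $\delta_\Sigma=\max_i\Sigma_{ii}$. $f(n)\lesssim g(n)$ (equivalently $g\gtrsim f$) means there is a constant $C>0$ independent of $n$ with $f(n)\le Cg(n)$ for all $n$. *)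

(* Defs.v *)
From HB Require Import structures.
From mathcomp Require Import all_boot all_order all_algebra.
From mathcomp Require Import all_classical all_reals all_analysis.

Set Implicit Arguments.
Unset Strict Implicit.
Unset Printing Implicit Defensive.

Import Order.TTheory GRing.Theory Num.Theory numFieldNormedType.Exports.

Local Open Scope classical_set_scope.
Local Open Scope ring_scope.

(* Random vectors live in p.-tuple R, which carries the product of the Borel
   sigma-algebras; vec turns them into columns for matrix algebra. *)
Definition vec (R : realType) (p : nat) (y : p.-tuple R) : 'cV[R]_p :=
  \col_i tnth y i.

Definition lqnorm (R : realType) (p : nat) (q : R) (a : 'cV[R]_p) : R :=
  (\sum_(i < p) `|a i 0| `^ q) `^ q^-1.

Definition spd (R : realType) (p : nat) (S : 'M[R]_p) : Prop :=
  S^T = S /\ forall v : 'cV[R]_p, v != 0 -> 0 < (v^T *m S *m v) 0 0.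

(* S is the (unique) symmetric positive definite square root of Sigma. *)
Definition is_mxsqrt (R : realType) (p : nat) (Sigma S : 'M[R]_p) : Prop :=
  spd S /\ S *m S = Sigma.

Definition lambda_min (R : realType) (p : nat) (S : 'M[R]_p) : R :=
  inf [set a | eigenvalue S a].

(* Diagonal entries of a positive definite matrix are positive, so the
   default value 0 of the big maximum is harmless when p > 0. *)
Definition max_diag (R : realType) (p : nat) (S : 'M[R]_p) : R :=
  \big[Num.max/0]_(i < p) S i i.

Definition alpha_of (R : realType) (p : nat) (mu : 'cV[R]_p)
    (Sigma : 'M[R]_p) : 'cV[R]_p :=
  invmx Sigma *m mu.

Definition theta_of (R : realType) (p : nat) (mu : 'cV[R]_p)
    (Sigma : 'M[R]_p) : R :=
  (mu^T *m invmx Sigma *m mu) 0 0.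

Definition Hq (R : realType) (p : nat) (q cL cU rad tau : R)
    (mu : 'cV[R]_p) (Sigma : 'M[R]_p) : Prop :=
  [/\ spd Sigma,
      lqnorm q (alpha_of mu Sigma) `^ q <= rad,
      theta_of mu Sigma <= tau,
      cL <= lambda_min Sigma <= max_diag Sigma
    & max_diag Sigma <= cU].

Definition noise_law (R : realType) (p : nat) (nu : R)
    (Q : probability (p.-tuple R) R) : Prop :=
  [/\ forall i : 'I_p, ('E_Q[fun y => tnth y i] = 0)%E,
      forall i j : 'I_p,
        ('E_Q[fun y => (tnth y i * tnth y j)%R] = ((i == j)%:R)%:E)%E
    & forall (b : 'cV[R]_p) (t : R), lqnorm 2 b = 1 -> 0 <= t ->
        (Q [set y | (t <= `|(b^T *m vec y) 0 0|)%R]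
           <= (2 * expR (- (t ^+ 2 / nu ^+ 2)))%:E)%E].

(* P is the joint law of n independent copies of Sigma^{1/2} y + mu, for some
   admissible noise y of law Q: it is the n-fold product of the law of
   Sigma^{1/2} y + mu, product measures being determined by their values on
   boxes. *)
Definition sample_law (R : realType) (n p : nat) (nu : R) (mu : 'cV[R]_p)
    (Sigma : 'M[R]_p) (P : probability (n.-tuple (p.-tuple R)) R) : Prop :=
  exists (Q : probability (p.-tuple R) R) (S : 'M[R]_p),
    [/\ noise_law nu Q, is_mxsqrt Sigma S
      & forall A : 'I_n -> set (p.-tuple R), (forall i, measurable (A i)) ->
          P [set x | forall i, A i (tnth x i)] =
          (\prod_(i < n)
             Q [set y | A i [tuple ((S *m vec y + mu) j 0)%R | j < p]])%E].

(* The supremum also ranges over the noise laws; the loss is nonnegative in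
   all uses, so the expectation is well defined, possibly +oo. *)
Definition minimax_risk (R : realType) (d : measure_display)
    (E : measurableType d) (n p : nat) (q cL cU nu rad tau : R)
    (loss : E -> 'cV[R]_p -> 'M[R]_p -> R) : \bar R :=
  ereal_inf [set s | exists2 est : n.-tuple (p.-tuple R) -> E,
    measurable_fun setT est &
    s = ereal_sup [set r |
      exists (mu : 'cV[R]_p) (Sigma : 'M[R]_p)
             (P : probability (n.-tuple (p.-tuple R)) R),
        [/\ Hq q cL cU rad tau mu Sigma, sample_law nu mu Sigma P
          & r = 'E_P[fun x => loss (est x) mu Sigma]%E]]].

Definition minimax_alpha (R : realType) (n p : nat)
    (q cL cU nu rad tau : R) : \bar R :=
  minimax_risk n q cL cU nu rad tau
    (fun (a : p.-tuple R) mu Sigma =>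
       lqnorm 2 (vec a - alpha_of mu Sigma) ^+ 2).

Definition minimax_theta (R : realType) (n p : nat)
    (q cL cU nu rad tau : R) : \bar R :=
  minimax_risk n q cL cU nu rad tau
    (fun (h : R) (mu : 'cV[R]_p) Sigma => `|h - theta_of mu Sigma|).

(* The sample size is positive: index 0 is ignored. *)
Definition lesssim (R : realType) (f g : nat -> \bar R) : Prop :=
  exists2 C : R, 0 < C & forall n, (0 < n)%N -> (f n <= C%:E * g n)%E.

Definition ttau (R : realType) (q cU rad tau : R) : R :=
  Num.min (cU * rad `^ (2 / q)) tau.

Definition tR (R : realType) (p : nat) (q cL rad tau : R) : R :=
  Num.min (p%:R `^ (1 - q / 2) * cL `^ (- (q / 2)) * tau `^ (q / 2)) rad.

(* Main.v *)
Require Import Defs.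
From HB Require Import structures.
From mathcomp Require Import all_boot all_order all_algebra.
From mathcomp Require Import all_classical all_reals all_analysis.
From mathcomp Require Import measurable_realfun ring lra zify.
From mathcomp Require complex sesquilinear spectral.

(* Every hypothesis has finite support. A coordinate of the observation is a
   multiple of [k u + V], where [V] is a sum of [N] Rademacher signs and [u] is
   either the constant 1 (when [T <= 1]) or the standardized first coordinate
   (when [T > 1], with a large mean on that coordinate). Replacing one sign of
   [V] by [u] has likelihood ratio [1 + u V / N], of second moment [1 + 1 / N]:
   it moves one coordinate of alpha by an amount of order [N^-1/2], and theta by
   an amount of order [1 / N] (of order [k / N] when [k > 0]), up to a power of
   [max 1 T]. Each noise vector is a linear image of independent signs, up to
   the random choice of the replaced sign, hence strictly sub-Gaussian.

   With [1 / N] of order [log p / n], at most one replaced coordinate in each of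
   [s] blocks of size about [p / s] cannot be located in its block, which gives
   (a), and the uniform mixture over such configurations cannot be told from
   the unperturbed law when [s ^ 2] is below [p], which gives the first term of
   (b). The second term of (b) is a two-point bound with [1 / N] of order
   [1 / n] and [k] of order [sqrt (T N)] on a single coordinate. *)

Set Implicit Arguments.
Unset Strict Implicit.
Unset Printing Implicit Defensive.

Import Order.TTheory GRing.Theory Num.Theory numFieldNormedType.Exports.

Local Open Scope classical_set_scope.
Local Open Scope ring_scope.

(** * Finitely supported laws *)

(** Since [nu] may be as small as [sqrt 2], no constant can be lost in the tails: each hypothesis
    needs a moment generating function bounded by that of the Gaussian with the same covariance. A
    replaced sign respects this because, given [u], it is deterministic and leaves [N - 1] free
    signs.

    The spectral constraints confine the covariance, so a theta above 1 has to come from a large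
    mean. Hiding the spikes in the correlations with the coordinate that carries this mean
    multiplies their effect on alpha by the amplitude [A] of the mean, and their effect on theta by
    [A ^ 2]; for [T <= 1] the spikes can sit in the mean itself.

    Two budgets limit the number [s] of spikes: [snr], of order [s / N], must stay below a multiple
    of [min T 1], which bounds theta and keeps the covariance near a multiple of the identity, and
    the power sum of alpha must stay below [rad]. Every smallness requirement is met by one constant
    [kap] that does not depend on the sample size. *)

Section FiniteLaw.
Context (R : realType) (d : measure_display) (T : measurableType d)
  (I : finType) (w : I -> R) (f : I -> T) (i0 : I).
Hypotheses (w_ge0 : forall i, 0 <= w i) (w_sum : \sum_i w i = 1).

(** [msum] adds a sequence of measures, so [I] is enumerated; [i0] is only the default of [nth]. *)
Let atom (k : nat) : {measure set T -> \bar R} :=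
  mscale (NngNum (w_ge0 (nth i0 (enum I) k))) (dirac (f (nth i0 (enum I) k))).

Let sum_atom (F : I -> R) :
  (\sum_(k < #|I|) (F (nth i0 (enum I) k))%:E = (\sum_i F i)%:E)%E.
Proof.
rewrite sumEFin; congr EFin.
rewrite (reindex (@enum_val I predT)) /=; last first.
  by exists enum_rank => x _; rewrite ?enum_valK ?enum_rankK.
by apply: eq_bigr => k _; rewrite /enum_val (set_nth_default i0) // -cardE.
Qed.

Definition finite_law : set T -> \bar R := msum atom #|I|.
HB.instance Definition _ := Measure.on finite_law.

Lemma finite_lawE A : finite_law A = (\sum_i w i * (f i \in A)%:R)%:E.
Proof.
rewrite -sum_atom /finite_law /= /msum; apply: eq_bigr => k _.
by rewrite /= /mscale /= diracE -EFinM.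
Qed.

Let law_setT : finite_law setT = 1%:E.
Proof.
rewrite finite_lawE -[RHS]/(1%:E) -[in RHS]w_sum; congr EFin.
by apply: eq_bigr => i _; rewrite mem_set ?mulr1.
Qed.

HB.instance Definition _ :=
  @Measure_isProbability.Build _ _ R finite_law law_setT.

Let ge0_integral_law (g : T -> R) : measurable_fun setT g ->
  (forall x, 0 <= g x) ->
  (\int[finite_law]_x (g x)%:E = (\sum_i w i * g (f i))%:E)%E.
Proof.
move=> mg g0; have mg' : measurable_fun setT (fun x => (g x)%:E : \bar R) by exact/measurable_EFinP.
rewrite ge0_integral_measure_sum//=; last by move=> x _; rewrite lee_fin.
rewrite -sum_atom; apply: eq_bigr => k _.
rewrite ge0_integral_mscale//=; last by move=> x _; rewrite lee_fin.
by rewrite integral_dirac// diracT mul1e.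
Qed.

Lemma finite_law_exists : exists P : probability T R,
  (forall A, P A = (\sum_i w i * (f i \in A)%:R)%:E) /\
  (forall g : T -> R, measurable_fun setT g ->
     'E_P[g] = (\sum_i w i * g (f i))%:E)%E.
Proof.
exists finite_law; split=> [A|g mg]; first exact: finite_lawE.
rewrite unlock integralE.
under eq_integral do rewrite funeposE /= -EFin_max.
under [X in (_ - X)%E]eq_integral do rewrite funenegE /= -[0%E]/(0%:E) -EFin_max.
rewrite !ge0_integral_law; last 4 first.
- by apply: measurable_maxr => //; exact: measurableT_comp.
- by move=> x; rewrite le_max lexx orbT.
- exact: measurable_maxr.
- by move=> x; rewrite le_max lexx orbT.
rewrite -EFinB -sumrB; congr EFin; apply: eq_bigr => i _.
rewrite -mulrBr; congr (_ * _).
by case: (leP (g (f i)) 0) => h; case: (leP (- g (f i)) 0) => h'; lra.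
Qed.

End FiniteLaw.

(** * Symmetric matrices *)

Module SymmetricMatrix.
Import complex sesquilinear spectral.

(** Functional calculus by polynomials: a function of a real symmetric matrix, written as a
    polynomial in it, stays real and symmetric although the diagonalization is complex. *)
Lemma interpolation (F : fieldType) (s : seq F) (g : F -> F) :
  exists f : {poly F}, forall x, x \in s -> f.[x] = g x.
Proof.
elim: s => [|a s [f fs]]; first by exists 0.
have [as_|as_] := boolP (a \in s).
  by exists f => x; rewrite inE => /orP[/eqP->|]; apply: fs.
pose P := \prod_(y <- s) ('X - y%:P).
have Pa : P.[a] != 0 by rewrite -[_ == 0]/(root P a) root_prod_XsubC.
exists (f + ((g a - f.[a]) / P.[a])%:P * P) => x.
rewrite inE !hornerE => /orP[/eqP->|xs].
  by rewrite mulfVK // addrC subrK.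
have /eqP -> : P.[x] == 0 by rewrite -[_ == 0]/(root P x) root_prod_XsubC.
by rewrite mulr0 addr0 fs.
Qed.

Section Symmetric.
Context (R : realType) (n : nat) (S : 'M[R]_n.+1).
Hypothesis S_sym : S^T = S.

Let toC : {rmorphism R -> R[i]} := real_complex R.
Let M : 'M[R[i]]_n.+1 := map_mx toC S.

Let M_herm : M \is hermsymmx.
Proof.
apply: realsym_hermsym.
  apply/is_hermitianmxP; rewrite expr0 scale1r map_mx_id // /M.
  by rewrite map_trmx S_sym.
by apply/mxOverP => i j; rewrite mxE; apply/complex_realP; exists (S i j).
Qed.

(** The spectral theorem is used over [R[i]]. The eigenvalues are real and descend to [S] as roots
    of its characteristic polynomial; [P] stays complex. *)
Lemma symmetric_diagonalization : exists (P : 'M[R[i]]_n.+1) (e : 'rV[R]_n.+1),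
  [/\ P \in unitmx, M = invmx P *m diag_mx (map_mx toC e) *m P
    & forall i, eigenvalue S (e 0 i)].
Proof.
have /hermitian_normalmx/orthomx_spectralP := M_herm.
have := hermitian_spectral_diag_real M_herm; have := spectral_unit M.
move: (spectralmx M) (spectral_diag M) => P d Pu /mxOverP dR ME.
have [e dE] : exists e : 'rV[R]_n.+1, forall i, (e 0 i)%:C%C = d 0 i.
  by exists (map_mx (@complex.Re R) d) => i; rewrite mxE; exact: RRe_real.
exists P, e; split; first exact: Pu.
  by rewrite ME (_ : map_mx toC e = d) //; apply/rowP => i; rewrite mxE -dE.
move=> i; rewrite eigenvalue_root_char -(fmorph_root toC) map_char_poly /=.
rewrite -[map_mx _ S]/M -eigenvalue_root_char dE.
apply/eigenvalueP; exists (row i P).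
  rewrite -row_mul ME !mulmxA mulmxV // mul1mx.
  by rewrite row_mul row_diag_mx -scalemxAl -rowE.
apply: contraTneq Pu => Pi0; rewrite -row_free_unit.
apply/negP => /row_freeP[Q PQ].
have /rowP/(_ i) : row i (P *m Q) = 0 by rewrite row_mul Pi0 mul0mx.
by rewrite PQ !mxE eqxx => /eqP; rewrite oner_eq0.
Qed.

End Symmetric.

Lemma trmx_horner (F : comNzRingType) n (A : 'M[F]_n.+1) (f : {poly F}) :
  (horner_mx A f)^T = horner_mx A^T f.
Proof.
elim/poly_ind: f => [|f c IH]; first by rewrite !rmorph0 trmx0.
rewrite !rmorphD !rmorphM /= !horner_mx_X !horner_mx_C linearD /=.
rewrite -!mulmxE trmx_mul IH tr_scalar_mx; congr (_ + _).
by apply: comm_mx_horner; apply: comm_mx_refl.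
Qed.

Lemma eigenvalue_symmetric_exists (R : realType) n (S : 'M[R]_n.+1) :
  S^T = S -> exists a, eigenvalue S a.
Proof.
by move=> /symmetric_diagonalization[P [e [_ _ He]]]; exists (e 0 0).
Qed.

Lemma sqnorm_gt0 (R : realType) n (v : 'cV[R]_n) : v != 0 ->
  0 < (v^T *m v) 0 0.
Proof.
move=> v0; rewrite mxE lt_neqAle eq_sym; apply/andP; split; last first.
  by apply: sumr_ge0 => i _; rewrite mxE -expr2 sqr_ge0.
apply: contra v0 => /eqP/psumr_eq0P H; apply/eqP/colP => i.
have /eqP := H (fun j _ => ltac:(by rewrite mxE -expr2 sqr_ge0)) i isT.
by rewrite !mxE -expr2 sqrf_eq0 => /eqP.
Qed.

(** The fourth root [T] is built first: the quadratic form of [T *m T] is then the squared norm of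
    [T *m v], so positivity follows from the injectivity of [T]. *)
Lemma spd_sqrt_exists (R : realType) n (S : 'M[R]_n.+1) :
  spd S -> exists T, is_mxsqrt S T.
Proof.
case=> S_sym S_pos.
have [P [e [Pu ME He]]] := symmetric_diagonalization S_sym.
have [f fe] := interpolation [seq e 0 i | i : 'I_n.+1] (fun x => Num.sqrt (Num.sqrt x)).
have e_gt0 i : 0 < e 0 i.
  have /eigenvalueP[v vS v0] := He i.
  have vT0 : v^T != 0 by rewrite trmx_eq0.
  have := S_pos _ vT0; rewrite trmxK vS -scalemxAl mxE.
  have := sqnorm_gt0 vT0; rewrite trmxK.
  by move=> h; rewrite pmulr_lgt0.
pose T := horner_mx S f.
have T_sym : T^T = T by rewrite trmx_horner S_sym.
have T4 : T *m T *m (T *m T) = S.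
  apply: (map_mx_inj (f := real_complex R)).
  rewrite -[in RHS](horner_mx_X S) mulmxE -!rmorphM /= !map_horner_mx ME.
  rewrite !(horner_mx_uconjC _ _ Pu).
  rewrite !horner_mx_diag.
  congr (_ *m diag_mx _ *m _).
  apply/rowP => i; rewrite !mxE !horner_map; congr (_ %:C%C).
  rewrite !hornerM fe; last by apply/mapP; exists i => //; rewrite mem_enum.
  transitivity ((Num.sqrt (Num.sqrt (e 0 i)) ^+ 2) ^+ 2); first by rewrite !expr2.
  have ei := ltW (e_gt0 i).
  by rewrite (sqr_sqrtr (sqrtr_ge0 _)) (sqr_sqrtr ei) hornerX.
exists (T *m T); split=> //; split=> [|v v0]; first by rewrite trmx_mul T_sym.
have -> : v^T *m (T *m T) *m v = (T *m v)^T *m (T *m v).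
  by rewrite trmx_mul T_sym !mulmxA.
apply: sqnorm_gt0; apply: contraTneq (S_pos v v0) => Tv0.
by rewrite -mulmxA -T4 -!mulmxA Tv0 !mulmx0 mxE ltxx.
Qed.

Lemma eigenvalue_ge (R : realType) n (S : 'M[R]_n) (c : R) :
  (forall v : 'cV[R]_n, c * (v^T *m v) 0 0 <= (v^T *m S *m v) 0 0) ->
  forall a, eigenvalue S a -> c <= a.
Proof.
move=> cS a /eigenvalueP[v vS v0].
have vT0 : v^T != 0 by rewrite trmx_eq0.
have := cS v^T; rewrite trmxK vS -scalemxAl [X in _ <= X]mxE.
by rewrite ler_pM2r //; have := sqnorm_gt0 vT0; rewrite trmxK.
Qed.

Lemma lambda_min_bounds (R : realType) n (S : 'M[R]_n.+1) (c : R) :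
  S^T = S ->
  (forall v : 'cV[R]_n.+1, c * (v^T *m v) 0 0 <= (v^T *m S *m v) 0 0) ->
  c <= lambda_min S <= max_diag S.
Proof.
move=> S_sym /eigenvalue_ge cS; apply/andP; split.
  (* The set of eigenvalues is nonempty, so the default value of [inf] does not intervene. *)
  by apply: lb_le_inf => //; exact: eigenvalue_symmetric_exists.
have [P [e [Pu SE He]]] := symmetric_diagonalization S_sym.
(* The trace is the sum of the eigenvalues, so they cannot all exceed the largest diagonal entry. *)
have trE : \sum_i S i i = \sum_i e 0 i.
  have := congr1 (fun M => \tr M) SE.
  rewrite -mulmxA mxtrace_mulC mulmxK // mxtrace_diag /mxtrace.
  under eq_bigr do rewrite mxE; under [RHS]eq_bigr do rewrite mxE.
  by rewrite -!rmorph_sum => /complexI.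
have [i ei] : exists i, e 0 i <= max_diag S.
  apply/not_existsP => H; suff : \sum_i S i i < \sum_i e 0 i by rewrite trE ltxx.
  apply: ltr_sum; first by apply/hasP; exists ord0 => //; rewrite mem_index_enum.
  move=> i _; apply: (@le_lt_trans _ _ (max_diag S)); first by rewrite /max_diag; apply: (le_bigmax _ (fun i => S i i)).
  by rewrite ltNge; apply/negP; exact: H.
apply: le_trans ei; apply: ge_inf; last exact: He.
by exists c => a /=; exact: cS.
Qed.

End SymmetricMatrix.
Import SymmetricMatrix.

(** * Sample laws with finite support *)

Lemma spd_unitmx (R : realType) n (S : 'M[R]_n) : spd S -> S \in unitmx.
Proof.
case=> S_sym S_pos; rewrite -row_free_unit -kermx_eq0; apply: contraT => K0.
have [i Ki] : exists i, row i (kermx S) != 0.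
  apply/existsP; apply: contraT; rewrite negb_exists => /forallP H.
  case/negP: K0; apply/eqP/row_matrixP => i; rewrite row0; apply/eqP.
  by have := H i; rewrite negbK.
have := S_pos (row i (kermx S))^T; rewrite trmx_eq0 trmxK => /(_ Ki).
by rewrite -row_mul mulmx_ker row0 mul0mx mxE ltxx.
Qed.

Lemma lqnorm2_sqr (R : realType) p (b : 'cV[R]_p) :
  lqnorm 2 b ^+ 2 = (b^T *m b) 0 0.
Proof.
rewrite /lqnorm -powR_mulrn ?powR_ge0 // -powRrM mulVf ?pnatr_eq0 // powRr1.
  rewrite mxE; apply: eq_bigr => i _; rewrite mxE.
  by rewrite powR_mulrn // real_normK ?num_real // expr2.
by apply: sumr_ge0 => i _; exact: powR_ge0.
Qed.

Section SampleLaw.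
Context (R : realType) (nu : R) (n p : nat) (Omega : finType) (o : Omega)
  (wt : Omega -> R) (Y : Omega -> 'cV[R]_p.+1) (mu : 'cV[R]_p.+1)
  (S : 'M[R]_p.+1).
Hypotheses (nu_ge : Num.sqrt 2 <= nu) (S_spd : spd S)
  (wt_ge0 : forall w, 0 <= wt w) (wt_sum : \sum_w wt w = 1)
  (Y_mean : \sum_w wt w *: (Y w - mu) = 0)
  (Y_cov : \sum_w wt w *: ((Y w - mu) *m (Y w - mu)^T) = S)
  (Y_mgf : forall c : 'cV[R]_p.+1,
    \sum_w wt w * expR ((c^T *m (Y w - mu)) 0 0)
      <= expR ((c^T *m S *m c) 0 0 / 2)).

Let tup (x : 'cV[R]_p.+1) : p.+1.-tuple R := [tuple x j 0 | j < p.+1].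

Let vec_tup x : vec (tup x) = x.
Proof. by apply/colP => i; rewrite mxE tnth_mktuple. Qed.

(* Markov's inequality for cosh (t Z) at the optimal exponent t *)
Lemma tail_bound (Z : Omega -> R) (t : R) :
  (forall s, \sum_w wt w * expR (s * Z w) <= expR (s ^+ 2 / 2)) -> 0 <= t ->
  \sum_w wt w * (t <= `|Z w|)%R%:R <= 2 * expR (- (t ^+ 2 / nu ^+ 2)).
Proof.
move=> mgf t0.
have nu2 : 2 <= nu ^+ 2.
  rewrite -[2](@sqr_sqrtr R) //.
  by rewrite ler_pXn2r ?nnegrE ?sqrtr_ge0 // (le_trans _ nu_ge) ?sqrtr_ge0.
(* Variance proxy 1 gives the exponent [t ^ 2 / 2], which [nu >= sqrt 2] turns into the required
   one. *)
apply: (@le_trans _ _ (2 * expR (- (t ^+ 2 / 2)))); last first.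
  rewrite ler_pM2l // ler_expR lerN2; apply: ler_wpM2l; first exact: sqr_ge0.
  by rewrite lef_pV2 ?posrE //; lra.
have tE : - (t ^+ 2 / 2) = - t ^+ 2 + t ^+ 2 / 2 by lra.
have -> : 2 * expR (- (t ^+ 2 / 2)) =
    expR (- t ^+ 2) * (expR (t ^+ 2 / 2) + expR ((- t) ^+ 2 / 2)).
  by rewrite sqrrN tE expRD; ring.
apply: (@le_trans _ _ (expR (- t ^+ 2) *
    \sum_w wt w * (expR (t * Z w) + expR (- t * Z w)))); last first.
  rewrite ler_pM2l ?expR_gt0 //.
  under eq_bigr do rewrite mulrDr.
  by rewrite big_split; apply: lerD.
rewrite mulr_sumr; apply: ler_sum => w _; rewrite mulrCA.
apply: ler_wpM2l => //; case: (leP t) => /= tZ; last first.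
  by rewrite mulr_ge0 ?addr_ge0 ?expR_ge0.
have [Z0|Z0] := leP 0 (Z w).
- rewrite ger0_norm // in tZ.
  rewrite mulrDr -!expRD ler_wpDr ?expR_ge0 // -expR0 ler_expR.
  nra.
- rewrite ltr0_norm // in tZ.
  rewrite mulrDr -!expRD ler_wpDl ?expR_ge0 // -expR0 ler_expR.
  nra.
Qed.

(** The noise is [Y - mu] whitened by the inverse square root [invmx Q0]. Whitening turns the
    Gaussian bound with covariance [S] into variance proxy 1 in every unit direction. *)
Lemma sample_law_exists :
  exists P : probability (n.-tuple (p.+1.-tuple R)) R,
    sample_law nu mu S P /\
    forall g, measurable_fun setT g ->
      ('E_P[g] = (\sum_(z : {ffun 'I_n -> Omega}) (\prod_i wt (z i)) *
         g [tuple tup (Y (z i)) | i < n])%:E)%E.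
Proof.
have [Q0 [[Q_sym Q_pos] QQ]] := spd_sqrt_exists S_spd.
have Qu := spd_unitmx (conj Q_sym Q_pos).
pose y w := invmx Q0 *m (Y w - mu).
have Qi_sym : (invmx Q0)^T = invmx Q0 by rewrite trmx_inv Q_sym.
have [Q [QA QE]] := finite_law_exists (fun w => tup (y w)) o wt_ge0 wt_sum.
have wz_ge0 (z : {ffun 'I_n -> Omega}) : 0 <= \prod_i wt (z i).
  by apply: prodr_ge0.
have wz_sum : \sum_(z : {ffun 'I_n -> Omega}) \prod_i wt (z i) = 1.
  rewrite -(bigA_distr_bigA (fun _ => wt)); apply: big1 => i _.
  exact: wt_sum.
have [P [PA PE]] := finite_law_exists
  (fun z : {ffun 'I_n -> Omega} => [tuple tup (Y (z i)) | i < n])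
  [ffun=> o] wz_ge0 wz_sum.
exists P; split=> //; exists Q, Q0; split.
- split=> [i|i j|b t b1 t0].
  + rewrite QE; last exact: measurable_tnth.
    congr EFin.
    transitivity ((invmx Q0 *m \sum_w wt w *: (Y w - mu)) i 0); last first.
      by rewrite Y_mean mulmx0 mxE.
    rewrite mulmx_sumr summxE; apply: eq_bigr => w _.
    by rewrite tnth_mktuple -scalemxAr [RHS]mxE.
  + rewrite QE; last by apply: measurable_funM; exact: measurable_tnth.
    congr EFin.
    transitivity ((invmx Q0 *m (\sum_w wt w *: ((Y w - mu) *m (Y w - mu)^T))
       *m (invmx Q0)^T) i j); last first.
      by rewrite Y_cov -QQ Qi_sym !mulmxA mulVmx // mul1mx mulmxV // mxE.
    rewrite mulmx_sumr mulmx_suml summxE; apply: eq_bigr => w _.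
    rewrite !tnth_mktuple -scalemxAr -scalemxAl [RHS]mxE; congr (_ * _).
    have -> : invmx Q0 *m ((Y w - mu) *m (Y w - mu)^T) *m (invmx Q0)^T =
        y w *m (y w)^T by rewrite /y trmx_mul !mulmxA.
    by rewrite [RHS]mxE big_ord1 [(y w)^T _ _]mxE.
  + rewrite QA lee_fin.
    (* The direction [b] of the noise is the direction [c] of [Y], along which the variance is the
       squared norm of [b]. *)
    pose c := invmx Q0 *m b.
    have cS : (c^T *m S *m c) 0 0 = 1.
      rewrite -QQ /c trmx_mul Qi_sym !mulmxA mulmxKV // mulmxK //.
      by rewrite -lqnorm2_sqr b1 expr1n.
    have bE w : (b^T *m vec (tup (y w))) 0 0 = (c^T *m (Y w - mu)) 0 0.
      by rewrite vec_tup /c trmx_mul Qi_sym mulmxA.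
    apply: le_trans (tail_bound (Z := fun w => (c^T *m (Y w - mu)) 0 0) _ t0).
      apply: ler_sum => w _; rewrite -bE; apply: ler_wpM2l => //.
      rewrite ler_nat; case: (boolP (_ \in _)) => // /set_mem /= ->.
      by [].
    move=> s; have cE (v : 'cV[R]_p.+1) :
      ((s *: c)^T *m v) 0 0 = s * (c^T *m v) 0 0.
      by rewrite linearZ /= -scalemxAl [LHS]mxE.
    have := Y_mgf (s *: c); rewrite -mulmxA cE mulmxA -scalemxAr [X in s * X]mxE.
    rewrite cS mulr1 -expr2; apply: le_trans.
    by apply: ler_sum => w _; rewrite cE.
- by split.
- move=> A mA; rewrite PA.
  under [in RHS]eq_bigr do rewrite QA.
  rewrite prodEFin; congr EFin.
  rewrite bigA_distr_bigA; apply: eq_bigr => z _; rewrite big_split /=.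
  congr (_ * _); have eQ w : Q0 *m vec (tup (y w)) + mu = Y w.
    by rewrite vec_tup /y mulKVmx // subrK.
  pose B i w := tup (y w) \in [set y0 | A i (tup (Q0 *m vec y0 + mu))].
  have BE i w : B i w = `[< A i (tup (Y w)) >].
    by apply/idP/asboolP => [/set_mem /=|H]; [|apply/mem_set => /=]; rewrite eQ.
  transitivity ([forall i, B i (z i)]%:R : R); last first.
    have [/forallP H|] := boolP [forall i, B i (z i)].
      by rewrite big1 // => i _; rewrite -/(B i (z i)) H.
    rewrite negb_forall => /existsP[i Bi].
    by rewrite (bigD1 i) //= -/(B i (z i)) (negbTE Bi) mul0r.
  congr (nat_of_bool _)%:R.
  apply/idP/forallP => [/set_mem /= H i|H].
    by rewrite BE; apply/asboolP; have := H i; rewrite tnth_mktuple.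
  apply/mem_set => i /=; rewrite tnth_mktuple.
  by apply/asboolP; rewrite -BE.
Qed.
End SampleLaw.

(** * Tilted Rademacher sums *)

Lemma double_fact_le (k : nat) : (2 ^ k * k`! <= (k.*2)`!)%N.
Proof.
elim: k => // k IH; rewrite doubleS !factS expnS.
have -> : (2 * 2 ^ k * (k.+1 * k`!) = (2 * k.+1) * (2 ^ k * k`!))%N by lia.
apply: leq_mul; first lia.
by apply: leq_trans IH _; rewrite leq_pmull.
Qed.

(** Term by term: the odd powers cancel and [2 ^ k * k! <= (2 k)!] compares the even ones. The limit
    is taken along partial sums of even length, where the cancellation is complete. *)
Lemma cosh_le_expR (R : realType) (x : R) :
  expR x + expR (- x) <= 2 * expR (x ^+ 2 / 2).
Proof.
have partial n : \sum_(k < n.*2) (exp_coeff x k + exp_coeff (- x) k) <=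
    2 * \sum_(k < n) exp_coeff (x ^+ 2 / 2) k.
  elim: n => [|n IH]; first by rewrite !big_ord0 mulr0.
  rewrite doubleS 3!big_ord_recr /= mulrDr.
  rewrite -addrA; apply: lerD => //.
  rewrite /exp_coeff /=.
  have Nx : (- x) ^+ n.*2 = x ^+ n.*2 by rewrite exprNn -signr_odd odd_double expr0 mul1r.
  rewrite (exprS x n.*2) (exprS (- x) n.*2) Nx mulNr.
  have -> : x ^+ n.*2 / (n.*2)`!%:R + x ^+ n.*2 / (n.*2)`!%:R +
    (x * x ^+ n.*2 / (n.*2.+1)`!%:R + - (x * x ^+ n.*2) / (n.*2.+1)`!%:R) =
    2 * (x ^+ n.*2 / (n.*2)`!%:R) by ring.
  rewrite ler_pM2l // expr_div_n -exprM mul2n -mulrA.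
  apply: ler_wpM2l; first by rewrite -mul2n exprM exprn_ge0 // sqr_ge0.
  rewrite -invfM lef_pV2 ?posrE; last 2 first.
  - by rewrite ltr0n fact_gt0.
  - by rewrite mulr_gt0 ?exprn_gt0 // ltr0n fact_gt0.
  by rewrite -natrX -natrM ler_nat double_fact_le.
have dbl : double @ \oo --> \oo.
  apply/cvgnyPge => N; near=> n; rewrite (@leq_trans n) // -?addnn ?leq_addr //.
  by near: n; exact: nbhs_infty_ge.
have cv (y : R) : series (exp_coeff y) \o double @ \oo --> expR y.
  by apply: cvg_comp dbl _; exact: is_cvg_series_exp_coeff.
have cvD : ((series (exp_coeff x) \o double) + (series (exp_coeff (- x)) \o double)) n
    @[n --> \oo] --> expR x + expR (- x).
  exact: cvgD (cv x) (cv (- x)).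
rewrite -(cvg_lim _ cvD) //; apply: limr_le.
  by apply/cvg_ex; exists (expR x + expR (- x)).
near=> n.
have -> : ((series (exp_coeff x) \o double) + (series (exp_coeff (- x)) \o double)) n
  = \sum_(k < n.*2) (exp_coeff x k + exp_coeff (- x) k).
  by rewrite big_split /= -!(big_mkord xpredT).
apply: le_trans (partial n) _; rewrite ler_pM2l // -(big_mkord xpredT).
have y0 : 0 <= x ^+ 2 / 2 by rewrite divr_ge0 ?sqr_ge0.
have mono : nondecreasing_seq (series (exp_coeff (x ^+ 2 / 2))).
  by apply/nondecreasing_seqP => k; rewrite seriesSr lerDl exp_coeff_ge0.
exact: (nondecreasing_cvgn_le mono (is_cvg_series_exp_coeff _) n).
Unshelve. all: by end_near. Qed.

Definition sgb (R : realType) (b : bool) : R := if b then 1 else -1.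

Definition cubesum (R : realType) (N : nat) (v : {ffun 'I_N -> bool}) : R :=
  \sum_i sgb R (v i).

Section Cube.
Context (R : realType) (N : nat).
Local Notation cube := {ffun 'I_N -> bool}.
Local Notation V := (@cubesum R N).

Lemma sgb_sqr b : sgb R b ^+ 2 = 1.
Proof. by case: b; rewrite /sgb ?sqrrN expr1n. Qed.

Lemma sgbN b : sgb R (~~ b) = - sgb R b.
Proof. by case: b; rewrite /= ?opprK. Qed.

Lemma card_cube : #|{: cube}|%:R = 2 ^+ N :> R.
Proof. by rewrite card_ffun card_bool card_ord natrX. Qed.

(** Flipping all signs is a bijection of the cube that negates the sum. *)
Lemma cube_odd (f : R -> R) : (forall x, f (- x) = - f x) ->
  \sum_(v : cube) f (V v) = 0.
Proof.
move=> f_odd; set s := \sum_v _.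
suff : s = - s by lra.
rewrite /s -[in RHS]sumrN (reindex_inj (h := fun v : cube => [ffun i => ~~ v i])) /=.
  apply: eq_bigr => v _; rewrite -f_odd; congr f; rewrite /cubesum -sumrN.
  by apply: eq_bigr => i _; rewrite ffunE sgbN.
by move=> v v' /ffunP vv; apply/ffunP => i; have := vv i; rewrite !ffunE => /negb_inj.
Qed.

Lemma cube_prod (f : 'I_N -> bool -> R) :
  \sum_(v : cube) \prod_i f i (v i) = \prod_i (f i true + f i false).
Proof. by rewrite -bigA_distr_bigA; apply: eq_bigr => i _; rewrite big_bool. Qed.

Lemma cube_sqr : \sum_(v : cube) V v ^+ 2 = N%:R * 2 ^+ N.
Proof.
under eq_bigr do rewrite expr2 big_distrlr /=.
rewrite exchange_big /=; under eq_bigr do rewrite exchange_big /=.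
transitivity (\sum_(i < N) (2 ^+ N : R)); last by rewrite sumr_const card_ord mulr_natl.
apply: eq_bigr => i _; rewrite (bigD1 i) //= [X in _ + X]big1 ?addr0; last first.
  move=> j ji.
  (* The product of two signs is padded with ones to a product over all coordinates, so that the sum
     over the cube factors; each of the two factors then vanishes. *)
  rewrite (eq_bigr (fun v : cube => \prod_k
    ((if k == i then sgb R (v k) else 1) * (if k == j then sgb R (v k) else 1)))).
    rewrite (cube_prod (fun k b => (if k == i then sgb R b else 1) * (if k == j then sgb R b else 1))).
    by rewrite (bigD1 i) //= eqxx eq_sym (negbTE ji) !mulr1 /sgb subrr mul0r.
  by move=> v _; rewrite big_split /= -!big_mkcond !big_pred1_eq.
rewrite -card_cube -sumr_const; apply: eq_bigr => v _.
by rewrite -expr2 sgb_sqr.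
Qed.

Lemma cube_exp (t : R) :
  \sum_(v : cube) expR (t * V v) = (expR t + expR (- t)) ^+ N.
Proof.
under eq_bigr do rewrite mulr_sumr expR_sum.
rewrite (cube_prod (fun _ b => expR (t * sgb R b))) /= mulr1 mulrN1.
by rewrite prodr_const card_ord.
Qed.

(** The derivative in [t] of the preceding identity, obtained one coordinate at a time. *)
Lemma cube_id_exp (t : R) :
  \sum_(v : cube) V v * expR (t * V v) =
  N%:R * ((expR t - expR (- t)) * (expR t + expR (- t)) ^+ N.-1).
Proof.
under eq_bigr do rewrite mulr_suml.
rewrite exchange_big /= mulr_natl -[in RHS](card_ord N) -sumr_const.
apply: eq_bigr => i _.
rewrite (eq_bigr (fun v : cube => \prod_k
    ((if k == i then sgb R (v k) else 1) * expR (t * sgb R (v k))))); last first.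
  by move=> v _; rewrite big_split /= -big_mkcond big_pred1_eq mulr_sumr expR_sum.
rewrite (cube_prod (fun k b => (if k == i then sgb R b else 1) * expR (t * sgb R b))).
rewrite (bigD1 i) //= eqxx mulr1 mulrN1 mul1r mulN1r; congr (_ * _).
rewrite (eq_bigr (fun=> expR t + expR (- t))) => [|k /negbTE ->]; last by rewrite !mul1r.
by rewrite prodr_const cardC1 card_ord.
Qed.

End Cube.

(** Setting the sign [v i] to [u] has density [1 + u * v i] with respect to the uniform law; the
    average over a uniformly chosen [i] is this expression. The flag [e] tells whether a sign is
    replaced. *)
Definition tilt (R : realType) (N : nat) (e : bool) (u : R)
    (v : {ffun 'I_N -> bool}) : R :=
  1 + e%:R * u * cubesum R v / N%:R.

Section Tilt.
Context (R : realType) (N : nat).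
Hypothesis N_gt1 : (1 < N)%N.
Local Notation cube := {ffun 'I_N -> bool}.
Local Notation V := (@cubesum R N).

Let Npos : 0 < N%:R :> R. Proof. by rewrite ltr0n ltnW. Qed.

Let N0 : N%:R != 0 :> R. Proof. exact: lt0r_neq0 Npos. Qed.

Let u2 (u : R) : `|u| = 1 -> u ^+ 2 = 1 :> R.
Proof. by move=> u1; rewrite -real_normK ?num_real // u1 expr1n. Qed.

Definition tilt_wt e (u : R) (v : cube) : R := tilt e u v / 2 ^+ N.

Lemma tilt_ge0 e (u : R) (v : cube) : `|u| = 1 -> 0 <= tilt e u v.
Proof.
move=> u1; suff : `|e%:R * u * V v / N%:R| <= 1.
  by rewrite /tilt ler_norml => /andP[+ _]; lra.
rewrite normrM normfV (gtr0_norm Npos) (ler_pdivrMr _ _ Npos) mul1r.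
rewrite !normrM u1 mulr1; apply: (@le_trans _ _ `|V v|).
  by case: e; rewrite ?normr1 ?mul1r ?normr0 ?mul0r.
rewrite -[X in _ <= X%:R](card_ord N) -[X in _ <= X]mul1r mulr_natr -sumr_const.
apply: le_trans (ler_norm_sum _ _ _) _; apply: ler_sum => i _.
by rewrite /sgb; case: (v i); rewrite ?normrN normr1.
Qed.

Lemma tilt_wt_ge0 e (u : R) (v : cube) : `|u| = 1 -> 0 <= tilt_wt e u v.
Proof. by move=> u1; rewrite divr_ge0 ?tilt_ge0 // exprn_ge0. Qed.

Let sum_tilt (e : bool) (u : R) (f : cube -> R) : \sum_v tilt_wt e u v * f v =
  (\sum_v f v + e%:R * u / N%:R * \sum_v V v * f v) / 2 ^+ N.
Proof.
rewrite mulr_sumr -big_split mulr_suml; apply: eq_bigr => v _ /=.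
by rewrite /tilt_wt /tilt; field; rewrite N0 expf_neq0.
Qed.

Let sum1 : \sum_(v : cube) 1 = 2 ^+ N :> R.
Proof. by rewrite sumr_const -card_cube. Qed.

Let sumV : \sum_(v : cube) V v = 0.
Proof. by rewrite (cube_odd N (f := id)). Qed.

Let sumVVV : \sum_(v : cube) V v * V v ^+ 2 = 0.
Proof. by rewrite (cube_odd N (f := fun x => x * x ^+ 2)) // => x; ring. Qed.

Let P2 : 2 ^+ N != 0 :> R. Proof. by rewrite expf_neq0. Qed.

Lemma tilt_wt_sum e (u : R) : \sum_(v : cube) tilt_wt e u v = 1.
Proof.
under eq_bigr do rewrite -[tilt_wt _ _ _]mulr1.
rewrite (sum_tilt e u (fun=> 1)) sum1.
by under eq_bigr do rewrite mulr1; rewrite sumV mulr0 addr0 divff.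
Qed.

Lemma tilt_wt_mean (e : bool) (u : R) : \sum_(v : cube) tilt_wt e u v * V v = e%:R * u.
Proof.
rewrite sum_tilt sumV; under eq_bigr do rewrite -expr2.
by rewrite cube_sqr; field; rewrite N0 P2.
Qed.

(** The replaced sign has no variance left given [u]; the third moment of the uniform law vanishes
    by symmetry. *)
Lemma tilt_wt_var (e : bool) (u : R) : `|u| = 1 ->
  \sum_(v : cube) tilt_wt e u v * (V v - e%:R * u) ^+ 2 = N%:R - e%:R.
Proof.
move=> u1.
transitivity (\sum_(v : cube) tilt_wt e u v * V v ^+ 2
  + (e%:R * u) ^+ 2 * \sum_(v : cube) tilt_wt e u v
  - 2 * (e%:R * u) * \sum_(v : cube) tilt_wt e u v * V v).
  rewrite !mulr_sumr -big_split -sumrB; apply: eq_bigr => v _ /=; ring.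
rewrite tilt_wt_sum tilt_wt_mean sum_tilt sumVVV cube_sqr mulr0 addr0 mulfK //.
by have := u2 u1; case: e => uu; rewrite ?mulr1n ?mulr0n; lra.
Qed.

(** Once centred, the tilted sum behaves as a sum of [N - e] independent signs, so the left side is
    exactly the power [N - e] of [cosh t]. *)
Lemma tilt_wt_mgf (e : bool) (u t : R) : `|u| = 1 ->
  \sum_(v : cube) tilt_wt e u v * expR (t * (V v - e%:R * u)) <=
    expR (t ^+ 2 * (N%:R - e%:R) / 2).
Proof.
move=> u1.
have -> : \sum_(v : cube) tilt_wt e u v * expR (t * (V v - e%:R * u)) =
    ((expR t + expR (- t)) / 2) ^+ (N - e).
  under eq_bigr do rewrite mulrBr expRD mulrA.
  rewrite -mulr_suml sum_tilt cube_exp cube_id_exp.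
  case: N N_gt1 => // n _; case: e => /=; last first.
    by rewrite subn0 ?mulr0n !(mul0r, mulr0, oppr0, expR0, addr0, mulr1) expr_div_n.
  rewrite subn1 /= !mul1r.
  have n1 : 1 + n%:R != 0 :> R by rewrite addrC natr1 pnatr_eq0.
  (* For a sign [u], [cosh t + u * sinh t] is [expR (u * t)], which cancels the centring. *)
  have [-> | ->] : u = 1 \/ u = -1.
  - by have /eqP := u2 u1; rewrite -[1 in X in X -> _](expr1n _ 2%N) eqf_sqr => /orP[/eqP->|/eqP->]; [left|right].
  - rewrite mulr1 expr_div_n expRN !exprS; field.
    by rewrite n1 !expf_neq0 ?gt_eqF ?expR_gt0.
  - rewrite mulrN1 opprK expr_div_n expRN !exprS; field.
    by rewrite n1 !expf_neq0 ?gt_eqF ?expR_gt0.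
have -> : t ^+ 2 * (N%:R - e%:R) / 2 = (N - e)%:R * (t ^+ 2 / 2).
  rewrite natrB; last by case: e => //; exact: ltnW.
  ring.
rewrite expRM_natl; apply: lerXn2r; rewrite ?nnegrE ?expR_ge0 ?divr_ge0 ?addr_ge0 ?expR_ge0 //.
by rewrite ler_pdivrMr // mulrC; exact: cosh_le_expR.
Qed.

Lemma tilt_sqr (u : R) : `|u| = 1 ->
  \sum_(v : cube) tilt true u v ^+ 2 / 2 ^+ N = 1 + N%:R^-1.
Proof.
move=> u1.
transitivity (\sum_(v : cube)
    (1 + 2 * u / N%:R * V v + u ^+ 2 / N%:R ^+ 2 * V v ^+ 2) / 2 ^+ N).
  by apply: eq_bigr => v _; rewrite /tilt /=; field; rewrite N0 P2.
rewrite -mulr_suml !big_split /= -!mulr_sumr sum1 sumV cube_sqr u2 //.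
by field; rewrite N0 P2.
Qed.

End Tilt.

(** * The hypotheses *)

Section Independence.
Context (R : realType) (I B : finType) (kappa : I -> B -> R).
Hypothesis kappa1 : forall j, \sum_b kappa j b = 1.

Lemma prod_expect (f : I -> B -> R) :
  \sum_(v : {ffun I -> B}) (\prod_j kappa j (v j)) * \prod_j f j (v j) =
  \prod_j \sum_b kappa j b * f j b.
Proof.
by rewrite bigA_distr_bigA; apply: eq_bigr => v _; rewrite -big_split.
Qed.

Lemma prod_expect0 : \sum_(v : {ffun I -> B}) \prod_j kappa j (v j) = 1.
Proof. by rewrite -bigA_distr_bigA big1. Qed.

Lemma prod_expect1 (j : I) (f : B -> R) :
  \sum_(v : {ffun I -> B}) (\prod_j kappa j (v j)) * f (v j) =
  \sum_b kappa j b * f b.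
Proof.
have /= := prod_expect (fun i b => if i == j then f b else 1).
under eq_bigr do rewrite -big_mkcond big_pred1_eq.
move=> ->; rewrite (bigD1 j) //= eqxx [X in _ * X]big1 ?mulr1 // => i /negbTE ->.
by under eq_bigr do rewrite mulr1.
Qed.

Lemma prod_expect2 (i j : I) (f g : B -> R) : i != j ->
  \sum_(v : {ffun I -> B}) (\prod_j kappa j (v j)) * (f (v i) * g (v j)) =
  (\sum_b kappa i b * f b) * (\sum_b kappa j b * g b).
Proof.
move=> ij.
have /= := prod_expect (fun k b =>
  (if k == i then f b else 1) * (if k == j then g b else 1)).
under eq_bigr do rewrite big_split -!big_mkcond !big_pred1_eq.
move=> ->; rewrite (bigD1 i) //= eqxx (negbTE ij); congr (_ * _).
  by apply: eq_bigr => b _; rewrite mulr1.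
have ji : j != i by rewrite eq_sym.
rewrite (bigD1 j) //= eqxx (negbTE ji) [X in _ * X]big1 ?mulr1.
  by apply: eq_bigr => b _; rewrite mul1r.
move=> l /andP[/negbTE -> /negbTE ->].
by under eq_bigr do rewrite !mulr1.
Qed.
End Independence.

Definition cons_col (R : realType) (P : nat) (a : R) (f : 'I_P -> R) : 'cV[R]_P.+1 :=
  \col_i if unlift ord0 i is Some j then f j else a.

Lemma cons_col0 (R : realType) P (a : R) (f : 'I_P -> R) : cons_col a f ord0 0 = a.
Proof. by rewrite mxE unlift_none. Qed.

Lemma cons_colS (R : realType) P (a : R) (f : 'I_P -> R) j :
  cons_col a f (lift ord0 j) 0 = f j.
Proof. by rewrite mxE liftK. Qed.

Section Model.
Context (R : realType) (P N : nat) (lg : bool) (sigma m h : R) (k : 'I_P -> R).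
Hypotheses (N_gt1 : (1 < N)%N).

Local Notation bits := {ffun 'I_P -> {ffun 'I_N -> bool}}.

Definition latent : finType := (bool * bits)%type.

(* The [u] of the header; [lg] says that [T > 1]. *)
Definition factor (b : bool) : R := if lg then sgb R b else 1.

Lemma factor_norm b : `|factor b| = 1.
Proof. by rewrite /factor /sgb; case: lg; case: b; rewrite ?normrN normr1. Qed.

(** When [lg] is false the first coordinate is an idle independent sign, so that both regimes share
    one latent space and one dimension. *)
Definition obs (w : latent) : 'cV[R]_P.+1 :=
  cons_col (m + sigma * sgb R w.1)
    (fun j => h * (k j * factor w.1 + cubesum R (w.2 j))).

Implicit Type J : {set 'I_P}.

(* [J] is the set of the coordinates in which one sign is replaced by [u]. *)
Definition obs_wt J (w : latent) : R :=
  2^-1 * \prod_j tilt_wt (j \in J) (factor w.1) (w.2 j).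

(** Given [u], a replaced sign has mean [u] and so adds 1 to the coefficient [k j] of [u]. *)
Definition loading J (j : 'I_P) : R := k j + (j \in J)%:R.

Definition obs_mean J : 'cV[R]_P.+1 :=
  cons_col m (fun j => if lg then 0 else h * loading J j).

Definition obs_dir J : 'cV[R]_P.+1 :=
  cons_col sigma (fun j => if lg then h * loading J j else 0).

Definition idio_var J : 'cV[R]_P.+1 :=
  cons_col 0 (fun j => h ^+ 2 * (N%:R - (j \in J)%:R)).

Definition obs_cov J : 'M[R]_P.+1 :=
  obs_dir J *m (obs_dir J)^T + diag_mx (idio_var J)^T.

Definition idio J (w : latent) : 'cV[R]_P.+1 :=
  cons_col 0 (fun j => h * (cubesum R (w.2 j) - (j \in J)%:R * factor w.1)).

(** The loadings belong to the mean when [u] is the constant 1 and to the common factor when [u] is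
    the sign of the first coordinate; the idiosyncratic part has the same form in both regimes. *)
Lemma obs_center J w :
  obs w - obs_mean J = sgb R w.1 *: obs_dir J + idio J w.
Proof.
apply/colP => i; rewrite !mxE; case: unliftP => [j|] _; last by ring.
rewrite /loading /factor; case: lg; ring.
Qed.

Lemma sum_latent (F : latent -> R) : \sum_w F w = \sum_b \sum_v F (b, v).
Proof. by rewrite pair_bigA; apply: eq_bigr => -[]. Qed.

Lemma obs_wt_ge0 J w : 0 <= obs_wt J w.
Proof.
by rewrite mulr_ge0 ?invr_ge0 // prodr_ge0 // => j _; rewrite tilt_wt_ge0 ?factor_norm.
Qed.

Lemma obs_wt_sum J : \sum_w obs_wt J w = 1.
Proof.
rewrite sum_latent (eq_bigr (fun=> 2^-1)) => [|b _].
  by rewrite big_bool /=; lra.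
rewrite -mulr_sumr (prod_expect0 (kappa := fun j => tilt_wt (j \in J) (factor b))) ?mulr1 //.
by move=> j; exact: tilt_wt_sum.
Qed.

Let kappa J b := fun j => @tilt_wt R N (j \in J) (factor b).
Let kappa1 J b j : \sum_v kappa J b j v = 1.
Proof. exact: tilt_wt_sum. Qed.

Let idio_mean J b : \sum_(v : bits) (\prod_j kappa J b j (v j)) *: idio J (b, v) = 0.
Proof.
apply/colP => i; rewrite summxE [RHS]mxE.
under eq_bigr do rewrite mxE.
case: (unliftP ord0 i) => [j|] ->; last first.
  by apply: big1 => v _; rewrite cons_col0 mulr0.
under eq_bigr do rewrite cons_colS /=.
rewrite (prod_expect1 (kappa1 J b) j (fun v => h * (cubesum R v - (j \in J)%:R * factor b))).
under eq_bigr do rewrite mulrCA mulrBr.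
rewrite -mulr_sumr sumrB -mulr_suml kappa1 mul1r.
by rewrite tilt_wt_mean // subrr mulr0.
Qed.

Let idio_cov J b : \sum_(v : bits) (\prod_j kappa J b j (v j)) *:
  (idio J (b, v) *m (idio J (b, v))^T) = diag_mx (idio_var J)^T.
Proof.
apply/matrixP => i i'; rewrite summxE.
under eq_bigr do rewrite mxE [(_ *m _) _ _]mxE big_ord1 [_^T _ _]mxE.
rewrite [RHS]mxE [_^T _ _]mxE.
case: (unliftP ord0 i) => [j|] ->; last first.
  by rewrite cons_col0 mul0rn big1 // => v _; rewrite cons_col0 mul0r mulr0.
case: (unliftP ord0 i') => [j'|] ->; last first.
  rewrite big1 => [|v _]; first by rewrite eq_sym (negbTE (neq_lift _ _)).
  by rewrite cons_col0 !mulr0.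
under eq_bigr do rewrite !cons_colS /=.
rewrite (inj_eq (@lift_inj _ _)) cons_colS.
pose f j (v : {ffun 'I_N -> bool}) := h * (cubesum R v - (j \in J)%:R * factor b).
have fE i0 : \sum_v kappa J b i0 v * f i0 v = 0.
  under eq_bigr do rewrite mulrCA mulrBr.
  rewrite -mulr_sumr sumrB -mulr_suml kappa1 mul1r.
  by rewrite tilt_wt_mean // subrr mulr0.
have [<-|jj'] := eqVneq j j'; last first.
  by rewrite (prod_expect2 (kappa1 J b) (f j) (f j')) // !fE mul0r.
rewrite (prod_expect1 (kappa1 J b) j (fun v => f j v * f j v)).
under eq_bigr do rewrite -expr2 exprMn mulrCA.
by rewrite -mulr_sumr tilt_wt_var ?factor_norm.
Qed.

Let sum_latentV (n1 n2 : nat) (F : latent -> 'M[R]_(n1, n2)) :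
  \sum_w F w = \sum_b \sum_v F (b, v).
Proof. by rewrite pair_bigA; apply: eq_bigr => -[]. Qed.

Lemma obs_wt_mean J : \sum_w obs_wt J w *: (obs w - obs_mean J) = 0.
Proof.
rewrite sum_latentV big_bool.
have bE b : \sum_(v : bits) obs_wt J (b, v) *: (obs (b, v) - obs_mean J) =
    (2^-1 * sgb R b) *: obs_dir J.
  under eq_bigr do rewrite obs_center /obs_wt -scalerA scalerDr.
  rewrite -scaler_sumr big_split /= -scaler_suml.
  by rewrite (prod_expect0 (kappa1 J b)) scale1r idio_mean addr0 scalerA.
by rewrite !bE /= -scalerDl /sgb mulrN mulr1 subrr scale0r.
Qed.

Lemma obs_wt_cov J : \sum_w obs_wt J w *:
  ((obs w - obs_mean J) *m (obs w - obs_mean J)^T) = obs_cov J.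
Proof.
rewrite sum_latentV.
have bE b : \sum_(v : bits) obs_wt J (b, v) *: ((obs (b, v) - obs_mean J) *m
    (obs (b, v) - obs_mean J)^T) = 2^-1 *: obs_cov J.
  (* The square is expanded with [s ^ 2 = 1]. The cross terms carry the mean of [idio] given the
     first sign, which is zero. *)
  transitivity (2^-1 *: (
    (\sum_(v : bits) \prod_j kappa J b j (v j)) *: (obs_dir J *m (obs_dir J)^T)
    + sgb R b *: (obs_dir J *m (\sum_(v : bits) (\prod_j kappa J b j (v j)) *: idio J (b, v))^T)
    + sgb R b *: ((\sum_(v : bits) (\prod_j kappa J b j (v j)) *: idio J (b, v)) *m (obs_dir J)^T)
    + \sum_(v : bits) (\prod_j kappa J b j (v j)) *: (idio J (b, v) *m (idio J (b, v))^T))); last first.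
    rewrite idio_mean idio_cov (prod_expect0 (kappa1 J b)) trmx0 mulmx0 mul0mx.
    by rewrite !scaler0 !addr0 scale1r.
  rewrite scaler_suml linear_sum /= mulmx_sumr mulmx_suml !scaler_sumr -!big_split /=.
  rewrite scaler_sumr; apply: eq_bigr => v _.
  rewrite obs_center /obs_wt -scalerA; congr (_ *: _).
  have := sgb_sqr R b; rewrite /=.
  move: (sgb R b) (\prod_j _) (obs_dir J) (idio J (b, v)) => s pv g x s2.
  apply/matrixP => i j; do !rewrite ?mxE ?big_ord1.
  rewrite -[pv * (g i 0 * g j 0)]mul1r -s2; ring.
by rewrite big_bool !bE /= -scalerDl (_ : 2^-1 + 2^-1 = 1) ?scale1r //; lra.
Qed.

Lemma quad_form J (c : 'cV[R]_P.+1) : (c^T *m obs_cov J *m c) 0 0 =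
  ((c^T *m obs_dir J) 0 0) ^+ 2 + \sum_i (idio_var J i 0) * c i 0 ^+ 2.
Proof.
rewrite mulmxDr mulmxDl [LHS]mxE; congr (_ + _).
  rewrite mulmxA -mulmxA mxE big_ord1 expr2; congr (_ * _).
  by rewrite !mxE; apply: eq_bigr => i _; rewrite !mxE mulrC.
rewrite mxE; apply: eq_bigr => i _.
by rewrite mul_mx_diag !mxE; ring.
Qed.

(** Given the first sign the coordinates are independent, and their joint bound [K] is the same for
    both signs; the remaining average over that sign is a hyperbolic cosine. *)
Lemma obs_wt_mgf J (c : 'cV[R]_P.+1) :
  \sum_w obs_wt J w * expR ((c^T *m (obs w - obs_mean J)) 0 0)
    <= expR ((c^T *m obs_cov J *m c) 0 0 / 2).
Proof.
pose a := (c^T *m obs_dir J) 0 0.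
pose t j := c (lift ord0 j) 0 * h.
have cE b v : (c^T *m (obs (b, v) - obs_mean J)) 0 0 = sgb R b * a +
    \sum_j t j * (cubesum R (v j) - (j \in J)%:R * factor b).
  rewrite obs_center mulmxDr -scalemxAr [LHS]mxE [X in X + _]mxE -/a; congr (_ + _).
  rewrite [LHS]mxE big_ord_recl cons_col0 mulr0 add0r; apply: eq_bigr => j _.
  by rewrite cons_colS mxE mulrA.
pose K := \prod_j expR (t j ^+ 2 * (N%:R - (j \in J)%:R) / 2).
have bE b : \sum_(v : bits) obs_wt J (b, v) * expR ((c^T *m (obs (b, v) - obs_mean J)) 0 0)
    <= 2^-1 * expR (sgb R b * a) * K.
  under eq_bigr do rewrite cE expRD expR_sum /obs_wt mulrACA.
  rewrite -mulr_sumr; apply: ler_wpM2l; first by rewrite mulr_ge0 ?expR_ge0 ?invr_ge0.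
  rewrite (prod_expect (kappa J b)
    (fun j v => expR (t j * (cubesum R v - (j \in J)%:R * factor b)))).
  apply: ler_prod => j _; apply/andP; split.
    by apply: sumr_ge0 => v _; rewrite mulr_ge0 ?expR_ge0 // tilt_wt_ge0 ?factor_norm.
  by apply: tilt_wt_mgf; rewrite ?factor_norm.
rewrite sum_latent; apply: (@le_trans _ _ (\sum_b 2^-1 * expR (sgb R b * a) * K)).
  by apply: ler_sum => b _.
rewrite big_bool /= mul1r mulN1r -mulrDl -mulrDr quad_form -/a mulrDl expRD.
apply: ler_pM.
- by rewrite mulr_ge0 ?invr_ge0 ?addr_ge0 ?expR_ge0.
- by apply: prodr_ge0 => j _; exact: expR_ge0.
- by rewrite ler_pdivrMl //; exact: cosh_le_expR.
- rewrite /K -expR_sum ler_expR mulr_suml big_ord_recl cons_col0 !mul0r add0r.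
  by apply: ler_sum => j _; rewrite cons_colS /t exprMn; lra.
Qed.

End Model.

(** * Membership of the models in the parameter space *)

Lemma lqnorm_powR (R : realType) p (q : R) (a : 'cV[R]_p) : 0 < q ->
  lqnorm q a `^ q = \sum_i `|a i 0| `^ q.
Proof.
move=> q0; rewrite /lqnorm -powRrM mulVf ?gt_eqF // powRr1 //.
by apply: sumr_ge0 => i _; exact: powR_ge0.
Qed.

(** Lagrange's identity: the difference of the two sides is half a double sum of squares. *)
Lemma cauchy_schwarz_sum (R : realType) (I : finType) (x y : I -> R) :
  (\sum_i x i * y i) ^+ 2 <= (\sum_i x i ^+ 2) * (\sum_i y i ^+ 2).
Proof.
have : 0 <= \sum_i \sum_j (x i * y j - x j * y i) ^+ 2.
  by apply: sumr_ge0 => i _; apply: sumr_ge0 => j _; exact: sqr_ge0.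
have -> : \sum_i \sum_j (x i * y j - x j * y i) ^+ 2 =
    \sum_i \sum_j (x i ^+ 2 * y j ^+ 2) + \sum_i \sum_j (y i ^+ 2 * x j ^+ 2)
    - 2 * \sum_i \sum_j (x i * y i) * (x j * y j).
  rewrite mulr_sumr -big_split -sumrB; apply: eq_bigr => i _ /=.
  by rewrite mulr_sumr -big_split -sumrB; apply: eq_bigr => j _ /=; ring.
rewrite -!big_distrlr /= expr2; lra.
Qed.

Section ModelClass.
Context (R : realType) (P N : nat) (lg : bool) (A c1 : R) (k : 'I_P -> R).
Hypotheses (N_gt1 : (1 < N)%N) (A_ge0 : 0 <= A) (A1 : ~~ lg -> A = 1)
  (c1_gt0 : 0 < c1) (k_ge0 : forall j, 0 <= k j).
Implicit Type J : {set 'I_P}.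

Definition noise_scale : R := Num.sqrt (c1 / N%:R).
Definition model_mean := obs_mean lg (if lg then A * Num.sqrt c1 else 0) noise_scale k.
Definition model_cov := obs_cov N lg (Num.sqrt c1) noise_scale k.

(** Squared loadings against idiosyncratic variances; the scale [noise_scale] cancels. *)
Definition snr J : R := \sum_j loading k J j ^+ 2 / (N%:R - (j \in J)%:R).

Local Notation h := noise_scale.
Local Notation s := (Num.sqrt c1).

Let s_gt0 : 0 < s. Proof. by rewrite sqrtr_gt0. Qed.
Let N_gt0 : 0 < N%:R :> R. Proof. by rewrite ltr0n ltnW. Qed.
Let h_gt0 : 0 < h. Proof. by rewrite sqrtr_gt0 divr_gt0. Qed.
Let h2 : h ^+ 2 = c1 / N%:R. Proof. by rewrite sqr_sqrtr // ltW ?divr_gt0. Qed.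
Let s2 : s ^+ 2 = c1. Proof. by rewrite sqr_sqrtr // ltW. Qed.
Let N'_ge J j : N%:R - 1 <= N%:R - (j \in J)%:R :> R.
Proof. by rewrite lerB // lern1 leq_b1. Qed.
Let N1 : 1 <= N%:R - 1 :> R.
Proof. have : 2 <= N%:R :> R by rewrite (ler_nat R 2). by lra. Qed.
Let N'_gt0 J j : 0 < N%:R - (j \in J)%:R :> R.
Proof. by apply: lt_le_trans (N'_ge J j); apply: lt_le_trans N1. Qed.
Let load_ge0 J j : 0 <= loading k J j.
Proof. by rewrite addr_ge0. Qed.

Lemma snr_ge0 J : 0 <= snr J.
Proof. by apply: sumr_ge0 => j _; rewrite divr_ge0 ?sqr_ge0 // ltW. Qed.

Lemma model_cov_sym J : (model_cov J)^T = model_cov J.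
Proof. by rewrite linearD /= trmx_mul trmxK tr_diag_mx. Qed.

(** The common factor contributes [(a + b) ^ 2], which is small only if [b] offsets [a]. A weighted
    Cauchy-Schwarz inequality bounds [b ^ 2] by [snr] times the idiosyncratic part [B], and
    [1 / N <= eta] bounds the variance lost with a replaced sign; together they cost a factor
    [1 - 2 * eta]. *)
Lemma model_cov_quad J (v : 'cV[R]_P.+1) (eta : R) : 0 < eta -> eta <= 1 / 2 ->
  N%:R^-1 <= eta -> snr J <= eta ^+ 2 ->
  c1 * (1 - 2 * eta) * (v^T *m v) 0 0 <= (v^T *m model_cov J *m v) 0 0.
Proof.
move=> eta0 eta1 Neta sn.
rewrite quad_form.
pose a := s * v ord0 0.
pose b := \sum_j (if lg then h * loading k J j else 0) * v (lift ord0 j) 0.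
pose B := \sum_j h ^+ 2 * (N%:R - (j \in J)%:R) * v (lift ord0 j) 0 ^+ 2.
pose W := \sum_j v (lift ord0 j) 0 ^+ 2.
have -> : (v^T *m obs_dir lg s h k J) 0 0 = a + b.
  rewrite mxE big_ord_recl mxE cons_col0 mulrC; congr (_ + _).
  by apply: eq_bigr => j _; rewrite mxE cons_colS mulrC.
have -> : \sum_i idio_var N h J i 0 * v i 0 ^+ 2 = B.
  rewrite big_ord_recl cons_col0 mul0r add0r.
  by apply: eq_bigr => j _; rewrite cons_colS.
have -> : (v^T *m v) 0 0 = v ord0 0 ^+ 2 + W.
  rewrite mxE big_ord_recl mxE -expr2; congr (_ + _).
  by apply: eq_bigr => j _; rewrite mxE -expr2.
have bB : b ^+ 2 <= snr J * B.
  have N'0 j : Num.sqrt (N%:R - (j \in J)%:R) != 0 :> R by rewrite gt_eqF // sqrtr_gt0.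
  pose x j := (if lg then loading k J j else 0) / Num.sqrt (N%:R - (j \in J)%:R).
  pose y j := h * Num.sqrt (N%:R - (j \in J)%:R) * v (lift ord0 j) 0.
  have -> : b = \sum_j x j * y j.
    apply: eq_bigr => j _; rewrite /x /y; case: lg; last by rewrite !mul0r.
    by field; exact: N'0.
  apply: le_trans (cauchy_schwarz_sum x y) _; apply: ler_pM.
  - by apply: sumr_ge0 => j _; exact: sqr_ge0.
  - by apply: sumr_ge0 => j _; exact: sqr_ge0.
  - apply: ler_sum => j _; rewrite /x expr_div_n sqr_sqrtr; last exact: ltW.
    by case: lg => //; rewrite expr2 !mul0r divr_ge0 ?sqr_ge0 // ltW.
  - by apply: ler_sum => j _; rewrite /y !exprMn (sqr_sqrtr (ltW (N'_gt0 J j))).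
have WB : c1 * (1 - eta) * W <= B.
  rewrite /W /B mulr_sumr; apply: ler_sum => j _; apply: ler_wpM2r; first exact: sqr_ge0.
  rewrite h2 -mulrA ler_pM2l // mulrC ler_pdivlMr // mulrBl mul1r.
  apply: le_trans (N'_ge J j); rewrite lerB //.
  by rewrite -ler_pdivrMr // div1r.
have B0 : 0 <= B.
  apply: sumr_ge0 => j _; apply: mulr_ge0; last exact: sqr_ge0.
  by apply: mulr_ge0; [exact: sqr_ge0|exact: ltW].
have a2 : a ^+ 2 = c1 * v ord0 0 ^+ 2 by rewrite exprMn s2.
have W0 : 0 <= W by apply: sumr_ge0 => j _; exact: sqr_ge0.
have bB' : b ^+ 2 <= eta ^+ 2 * B by apply: le_trans bB _; exact: ler_wpM2r.
(* completing the square in [eta * a + b] *)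
have ab : (1 - eta) * a ^+ 2 - (eta^-1 - 1) * b ^+ 2 <= (a + b) ^+ 2.
  rewrite -subr_ge0.
  have -> : (a + b) ^+ 2 - ((1 - eta) * a ^+ 2 - (eta^-1 - 1) * b ^+ 2) =
     eta^-1 * (eta * a + b) ^+ 2 by field; rewrite gt_eqF.
  by rewrite mulr_ge0 ?sqr_ge0 // invr_ge0 ltW.
have bB2 : (eta^-1 - 1) * b ^+ 2 <= eta * (1 - eta) * B.
  have -> : eta * (1 - eta) * B = (eta^-1 - 1) * (eta ^+ 2 * B).
    by field; rewrite gt_eqF.
  apply: ler_wpM2l => //; rewrite subr_ge0 invf_ge1 //; lra.
have -> : c1 * (1 - 2 * eta) * (v ord0 0 ^+ 2 + W) =
  (1 - 2 * eta) * a ^+ 2 + c1 * (1 - 2 * eta) * W by rewrite a2; ring.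
have e1 : 0 <= eta * a ^+ 2 by rewrite mulr_ge0 ?sqr_ge0 // ltW.
have e2 : 0 <= eta ^+ 2 * B by rewrite mulr_ge0 ?sqr_ge0.
have e3 : c1 * (1 - eta) * W * (1 - eta) <= B * (1 - eta).
  by apply: ler_wpM2r => //; lra.
have e4 : 0 <= c1 * eta ^+ 2 * W.
  by rewrite mulr_ge0 // mulr_ge0 ?sqr_ge0 // ltW.
lra.
Qed.

(** Definiteness holds without a smallness condition: the diagonal part controls all coordinates but
    the first, and the common factor then controls that one. *)
Lemma model_cov_spd J : spd (model_cov J).
Proof.
split=> [|v v0]; first exact: model_cov_sym.
rewrite quad_form; have v2 := sqnorm_gt0 v0.
have D_ge0 : 0 <= \sum_i idio_var N h J i 0 * v i 0 ^+ 2.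
  rewrite big_ord_recl cons_col0 mul0r add0r; apply: sumr_ge0 => j _.
  rewrite cons_colS; apply: mulr_ge0; last exact: sqr_ge0.
  by apply: mulr_ge0; [exact: sqr_ge0|exact: ltW].
rewrite lt_neqAle addr_ge0 ?sqr_ge0 // andbT eq_sym.
apply: contra v0; rewrite paddr_eq0 ?sqr_ge0 // sqrf_eq0 => /andP[/eqP g0].
rewrite big_ord_recl cons_col0 mul0r add0r psumr_eq0; last first.
  move=> j _; rewrite cons_colS; apply: mulr_ge0; last exact: sqr_ge0.
  by apply: mulr_ge0; [exact: sqr_ge0|exact: ltW].
move=> /allP vS.
have vj j : v (lift ord0 j) 0 = 0.
  have /implyP/(_ isT) := vS j (mem_index_enum j).
  rewrite cons_colS mulf_eq0 mulf_eq0 sqrf_eq0 sqrf_eq0.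
  by rewrite gt_eqF // gt_eqF //= => /eqP.
have v00 : v ord0 0 = 0.
  move: g0; rewrite mxE big_ord_recl big1 => [|j _]; last by rewrite mxE vj mul0r.
  by rewrite addr0 mxE cons_col0 => /eqP; rewrite mulf_eq0 [_ == 0 :> R in X in _ || X]gt_eqF // orbF => /eqP.
apply/eqP/colP => i; rewrite [RHS]mxE.
by case: (unliftP ord0 i) => [j|] ->.
Qed.

(** Solves the linear system for alpha. The first coordinate has no idiosyncratic variance, so its
    row fixes the scalar product of alpha with [obs_dir] ([A] or 0); the other rows are then
    diagonal, and that scalar product gives back the first entry. *)
Definition model_alpha J : 'cV[R]_P.+1 :=
  cons_col (if lg then A / s * (1 + snr J) else 0)
    (fun j => (if lg then - A else A) *
              (loading k J j / (h * (N%:R - (j \in J)%:R)))).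

Lemma model_alphaE J : alpha_of (model_mean J) (model_cov J) = model_alpha J.
Proof.
suff E : model_cov J *m model_alpha J = model_mean J.
  by rewrite /alpha_of -E mulKmx // spd_unitmx //; exact: model_cov_spd.
have N'0 j : N%:R - (j \in J)%:R != 0 :> R by rewrite gt_eqF.
have h0 : h != 0 by rewrite gt_eqF.
have s0 : s != 0 by rewrite gt_eqF.
have gE : (obs_dir lg s h k J)^T *m model_alpha J = (if lg then A else 0)%:M.
  apply/matrixP => i i'; rewrite !ord1 [RHS]mxE mulr1n mxE big_ord_recl mxE !cons_col0.
  under eq_bigr do rewrite mxE !cons_colS.
  case: lg; last by rewrite mulr0 add0r big1 // => j _; rewrite mul0r.
  rewrite (eq_bigr (fun j => - A * (loading k J j ^+ 2 / (N%:R - (j \in J)%:R)))); last first.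
    by move=> j _; field; rewrite h0 N'0.
  by rewrite -mulr_sumr -/(snr J); field.
rewrite mulmxDl -mulmxA gE mul_mx_scalar mul_diag_mx.
apply/colP => i; rewrite !mxE.
case: unliftP => [j|] _ /=.
  case: (boolP lg) => L; rewrite ?mul0r ?add0r; last rewrite A1 //.
    by field; rewrite h0 N'0.
  by field; rewrite h0 N'0.
by case: lg; rewrite ?mul0r ?add0r ?addr0 // mulrC.
Qed.

(** The factor [A ^ 2] on the contribution of the spikes is the source of [Num.max 1 T] in the
    rates. *)
Lemma model_thetaE J : theta_of (model_mean J) (model_cov J) = A ^+ 2 * (lg%:R + snr J).
Proof.
rewrite /theta_of -mulmxA -/(alpha_of _ _) model_alphaE mxE big_ord_recl mxE !cons_col0.
under eq_bigr do rewrite mxE !cons_colS.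
have N'0 j : N%:R - (j \in J)%:R != 0 :> R by rewrite gt_eqF.
have h0 : h != 0 by rewrite gt_eqF.
have s0 : s != 0 by rewrite gt_eqF.
case: (boolP lg) => L.
  rewrite big1 ?addr0 => [|j _]; last by rewrite mul0r.
  by rewrite mulr1n; field.
rewrite mul0r add0r (A1 L) expr1n mul1r add0r; apply: eq_bigr => j _.
by rewrite mul1r; field; rewrite h0 N'0.
Qed.

(** With [c1] the midpoint, [eta] satisfies [c1 * (1 - 2 * eta) = cL] and [c1 * (1 + 2 * eta) = cU],
    so perturbations of relative size [eta] respect both spectral constraints. *)
Lemma model_Hq (q cL cU rad tau eta : R) J : 0 < q ->
  c1 = (cL + cU) / 2 -> 0 < cL -> cL < cU -> eta = (c1 - cL) / (2 * c1) ->
  N%:R^-1 <= eta -> snr J <= eta ^+ 2 ->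
  A ^+ 2 * (lg%:R + snr J) <= tau ->
  lg%:R * (A / s * (1 + snr J)) `^ q
    + \sum_j (A * (loading k J j / (h * (N%:R - (j \in J)%:R)))) `^ q <= rad ->
  Hq q cL cU rad tau (model_mean J) (model_cov J).
Proof.
move=> q0 c1E cL0 cLU etaE Neta sn th lq.
have eta0 : 0 < eta by rewrite etaE divr_gt0 ?mulr_gt0 //; lra.
have c1eta : c1 * (1 - 2 * eta) = cL by rewrite etaE; field; rewrite gt_eqF.
have eta1 : eta <= 1 / 2.
  by rewrite etaE ler_pdivrMr ?mulr_gt0 //; lra.
split.
- exact: model_cov_spd.
- rewrite lqnorm_powR // model_alphaE; apply: le_trans lq.
  rewrite big_ord_recl cons_col0; apply: lerD.
    case: lg; last by rewrite mul0r normr0 powR0 // gt_eqF.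
    rewrite mul1r ger0_norm // mulr_ge0 ?divr_ge0 ?addr_ge0 ?snr_ge0 //; exact: ltW.
  apply: ler_sum => j _; rewrite cons_colS.
  have L0 : 0 <= loading k J j / (h * (N%:R - (j \in J)%:R)).
    by rewrite divr_ge0 // mulr_ge0 // ltW.
  by case: lg; rewrite ?mulNr ?normrN ger0_norm // mulr_ge0.
- by rewrite model_thetaE.
- apply: lambda_min_bounds => [|v]; first exact: model_cov_sym.
  by rewrite -[X in X * _]c1eta; exact: model_cov_quad.
- rewrite /max_diag; apply: bigmax_le => [|i _]; first by lra.
  rewrite mxE [X in X + _]mxE big_ord1 [X in _ * X + _]mxE [X in _ + X]mxE eqxx mulr1n [X in _ + X]mxE.
  case: (unliftP ord0 i) => [j|] ->; last first.
    by rewrite !cons_col0 addr0 -expr2 s2; lra.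
  rewrite !cons_colS.
  have lN : loading k J j ^+ 2 / N%:R <= snr J.
    rewrite /snr (bigD1 j) //=; apply: ler_wpDr.
      by apply: sumr_ge0 => i' _; rewrite divr_ge0 ?sqr_ge0 // ltW.
    apply: ler_wpM2l; first exact: sqr_ge0.
    by rewrite lef_pV2 ?posrE // gerBl.
  have H1 : (if lg then h * loading k J j else 0) ^+ 2 <= c1 * (loading k J j ^+ 2 / N%:R).
    case: lg; first by rewrite exprMn h2 mulrAC mulrA.
    by rewrite expr2 mul0r mulr_ge0 ?divr_ge0 ?sqr_ge0 // ltW.
  have H2 : h ^+ 2 * (N%:R - (j \in J)%:R) <= c1.
    rewrite h2 -[X in _ <= X](@mulfVK _ N%:R) ?gt_eqF //.
    by apply: ler_wpM2l; [rewrite ltW // divr_gt0|rewrite gerBl].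
  rewrite -expr2.
  have H3 : c1 * (loading k J j ^+ 2 / N%:R) <= c1 * eta ^+ 2.
    by rewrite ler_pM2l //; exact: le_trans lN sn.
  have H4 : c1 * eta ^+ 2 <= c1 * eta by rewrite ler_pM2l // expr2; nra.
  have : c1 * (1 - 2 * eta) = c1 - 2 * (c1 * eta) by ring.
  lra.
Qed.

End ModelClass.

(** * Likelihood ratios and minimax bounds *)

Section SampleWeights.
Context (R : realType) (P N : nat) (lg : bool) (n : nat).
Hypotheses (N_gt1 : (1 < N)%N).
Implicit Type J : {set 'I_P}.
Local Notation Z := {ffun 'I_n -> latent P N}.
Local Notation G := ((1 + N%:R^-1 : R) ^+ n).

Definition sample_wt J (z : Z) : R := \prod_i obs_wt R lg J (z i).

Definition sample_lr (j : 'I_P) (z : Z) : R :=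
  \prod_i tilt true (factor R lg (z i).1) ((z i).2 j).

Let u1 b : `|factor R lg b| = 1. Proof. exact: factor_norm. Qed.

Lemma sample_wt_ge0 J z : 0 <= sample_wt J z.
Proof. by apply: prodr_ge0 => i _; exact: obs_wt_ge0. Qed.

Let sum_sample (g : latent P N -> R) :
  \sum_(z : Z) \prod_i g (z i) = (\sum_w g w) ^+ n.
Proof. by rewrite -(bigA_distr_bigA (fun _ => g)) prodr_const card_ord. Qed.

Lemma sample_wt_sum J : \sum_z sample_wt J z = 1.
Proof. by rewrite sum_sample obs_wt_sum // expr1n. Qed.

Lemma sample_wt_setU1 J j z : j \notin J ->
  sample_wt (j |: J) z = sample_wt J z * sample_lr j z.
Proof.
move=> jJ; rewrite -big_split; apply: eq_bigr => i _ /=.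
rewrite /obs_wt -mulrA; congr (_ * _).
rewrite (bigD1 j) //= [in RHS](bigD1 j) //= finset.setU11 (negbTE jJ) mulrAC.
congr (_ * _).
  by rewrite /tilt_wt /tilt !mul0r addr0 mul1r mulrC.
by apply: eq_bigr => j' jj'; rewrite finset.in_setU1 (negbTE jj').
Qed.

Lemma sample_wtE J z :
  sample_wt J z = sample_wt finset.set0 z * \prod_(j in J) sample_lr j z.
Proof.
rewrite /sample_wt /sample_lr exchange_big /= -big_split; apply: eq_bigr => i _ /=.
rewrite /obs_wt -mulrA; congr (_ * _).
rewrite [X in _ * X]big_mkcond /= -big_split; apply: eq_bigr => j _ /=.
rewrite inE; case: (j \in J); last by rewrite mulr1.
by rewrite /tilt_wt /tilt !mul0r addr0 mul1r mulrC.
Qed.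

Let latent_prod (f : bool -> 'I_P -> {ffun 'I_N -> bool} -> R) (c : 'I_P -> R) :
  (forall b j, \sum_v f b j v = c j) ->
  \sum_(w : latent P N) 2^-1 * \prod_j f w.1 j (w.2 j) = \prod_j c j.
Proof.
move=> fc; rewrite sum_latent (eq_bigr (fun=> 2^-1 * \prod_j c j)) => [|b _].
  by rewrite big_bool /=; lra.
by rewrite -mulr_sumr -(bigA_distr_bigA (f b)); congr (_ * _); apply: eq_bigr.
Qed.

(** The base law may already carry spikes elsewhere, which allows the comparison inside one block
    while the other blocks are frozen. *)
Lemma sample_lr_sqr J j : j \notin J ->
  \sum_z sample_wt J z * sample_lr j z ^+ 2 = G.
Proof.
move=> jJ.
under eq_bigr do rewrite -prodrXl -big_split /=.
rewrite (sum_sample (fun w => obs_wt R lg J w * tilt true (factor R lg w.1) (w.2 j) ^+ 2)).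
congr (_ ^+ n).
pose f b j' v := @tilt_wt R N (j' \in J) (factor R lg b) v *
  (if j' == j then tilt true (factor R lg b) v ^+ 2 else 1).
transitivity (\sum_(w : latent P N) 2^-1 * \prod_j' f w.1 j' (w.2 j')).
  apply: eq_bigr => w _; rewrite /f /obs_wt [in RHS]big_split /= -big_mkcond big_pred1_eq.
  exact/esym/mulrA.
rewrite (@latent_prod f (fun j' => if j' == j then 1 + N%:R^-1 else 1)).
  by rewrite -big_mkcond big_pred1_eq.
move=> b j'; rewrite /f; case: eqP => [->|_].
  rewrite (negbTE jJ) -(tilt_sqr N_gt1 (u1 b)); apply: eq_bigr => v _.
  by rewrite /tilt_wt [X in X / _]/tilt !mul0r addr0 mul1r mulrC.
by under eq_bigr do rewrite mulr1; exact: tilt_wt_sum.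
Qed.

(** A coordinate in only one of the sets contributes the mean 1 of its likelihood ratio. Only the
    overlap contributes second moments, so the mixture is judged by the overlap of two independent
    configurations. *)
Lemma sample_lr_cross J J' :
  \sum_z sample_wt finset.set0 z *
    ((\prod_(j in J) sample_lr j z) * (\prod_(j in J') sample_lr j z)) =
  G ^+ #|J :&: J'|.
Proof.
pose t b v := @tilt R N true (factor R lg b) v.
pose f b j v := (@tilt_wt R N false (factor R lg b) v *
  (if j \in J then t b v else 1)) * (if j \in J' then t b v else 1).
transitivity (\sum_(z : Z) \prod_i (2^-1 * \prod_j f (z i).1 j ((z i).2 j))).
  apply: eq_bigr => z _.
  have lrE (J0 : {set 'I_P}) : \prod_(j in J0) sample_lr j z = \prod_i \prod_(j < P)
      (if j \in J0 then t (z i).1 ((z i).2 j) else 1).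
    rewrite /sample_lr exchange_big; apply: eq_bigr => i _.
    by rewrite big_mkcond.
  rewrite !lrE -!big_split; apply: eq_bigr => i _ /=.
  rewrite /obs_wt -mulrA -!big_split; congr (_ * _); apply: eq_bigr => j _ /=.
  by rewrite inE mulrA.
rewrite (sum_sample (fun w => 2^-1 * \prod_j f w.1 j (w.2 j))) exprAC.
congr (_ ^+ n).
rewrite (@latent_prod f (fun j => if j \in J :&: J' then 1 + N%:R^-1 else 1)).
  by rewrite -big_mkcond prodr_const.
have fE b v : @tilt_wt R N false (factor R lg b) v * t b v = tilt_wt true (factor R lg b) v.
  by rewrite /tilt_wt [X in X / _]/tilt !mul0r addr0 mul1r mulrC.
move=> b j; rewrite /f inE; case: (j \in J); case: (j \in J') => /=.
- rewrite -(tilt_sqr N_gt1 (u1 b)); apply: eq_bigr => v _.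
  by rewrite fE /tilt_wt mulrAC -expr2.
- by under eq_bigr do rewrite mulr1 fE; exact: tilt_wt_sum.
- by under eq_bigr do rewrite mulr1 fE; exact: tilt_wt_sum.
- by under eq_bigr do rewrite !mulr1; exact: tilt_wt_sum.
Qed.

End SampleWeights.

Section MinimaxReduction.
Context (R : realType) (P N : nat) (lg : bool) (A c1 : R) (k : 'I_P -> R).
Context (n : nat) (nu q cL cU rad tau : R).
Context (d : measure_display) (E : measurableType d)
  (loss : E -> 'cV[R]_P.+1 -> 'M[R]_P.+1 -> R).
Hypotheses (N_gt1 : (1 < N)%N) (c1_gt0 : 0 < c1) (nu_ge : Num.sqrt 2 <= nu).
Hypothesis loss_meas : forall mu Sigma, measurable_fun setT (fun e => loss e mu Sigma).

Definition sample_of (z : {ffun 'I_n -> latent P N}) : n.-tuple (P.+1.-tuple R) :=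
  [tuple [tuple obs lg (Num.sqrt c1) (if lg then A * Num.sqrt c1 else 0)
            (noise_scale N c1) k (z i) j 0 | j < P.+1] | i < n].

(** The statistician may be given the latent signs: an estimator composed with [sample_of] is a
    function on a finite set, for which measurability is no longer an issue. *)
Lemma minimax_risk_ge (I : finType) (J : I -> {set 'I_P}) (B : R) :
  (forall f, Hq q cL cU rad tau (model_mean N lg A c1 k (J f)) (model_cov N lg c1 k (J f))) ->
  (forall est : {ffun 'I_n -> latent P N} -> E, exists f, B <=
     \sum_z sample_wt R lg (J f) z *
       loss (est z) (model_mean N lg A c1 k (J f)) (model_cov N lg c1 k (J f))) ->
  (B%:E <= minimax_risk n q cL cU nu rad tau loss)%E.
Proof.
move=> JHq Jrisk; apply: le_ereal_inf_tmp => _ [est est_meas ->].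
have [f fB] := Jrisk (est \o sample_of).
pose o := (true, [ffun=> [ffun=> true]]) : bool * {ffun 'I_P -> {ffun 'I_N -> bool}}.
have [Pr [Pr_law PrE]] := sample_law_exists n (o : latent P N) nu_ge
  (model_cov_spd lg k N_gt1 c1_gt0 (J f))
  (obs_wt_ge0 R lg N_gt1 (J f)) (obs_wt_sum R lg N_gt1 (J f))
  (obs_wt_mean lg (Num.sqrt c1) (if lg then A * Num.sqrt c1 else 0)
    (noise_scale N c1) k N_gt1 (J f))
  (obs_wt_cov lg _ _ _ k N_gt1 (J f)) (obs_wt_mgf lg _ _ _ k N_gt1 (J f)).
apply: le_ereal_sup_tmp; eexists.
  by exists (model_mean N lg A c1 k (J f)), (model_cov N lg c1 k (J f)), Pr; split.
rewrite PrE; last exact: (measurableT_comp (loss_meas _ _) est_meas).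
by rewrite lee_fin; exact: fB.
Qed.

End MinimaxReduction.

(* With [Lbar] the average likelihood ratio, [min 1 Lbar >= 3/4 - (1 - Lbar)^2]. *)
Lemma fuzzy_two_point (R : realType) (Z F : finType) (w : Z -> R) (L : F -> Z -> R)
    (a0 a1 : Z -> R) (D : R) :
  (0 < #|F|)%N -> (forall z, 0 <= w z) -> \sum_z w z = 1 ->
  (forall f z, 0 <= L f z) -> (forall f, \sum_z w z * L f z = 1) ->
  \sum_f \sum_f' \sum_z w z * (L f z * L f' z) <= 3 / 2 * #|F|%:R ^+ 2 ->
  (forall z, 0 <= a0 z) -> (forall z, 0 <= a1 z) -> 0 <= D ->
  (forall z, D <= a0 z + a1 z) ->
  exists o : option F, D / 8 <=
    \sum_z w z * (if o is Some f then L f z * a1 z else a0 z).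
Proof.
move=> F0 w0 w1 L0 L1 L2 a00 a10 D0 Da.
have F0' : 0 < #|F|%:R :> R by rewrite ltr0n.
pose Lb z := (\sum_f L f z) / #|F|%:R.
have Lb0 z : 0 <= Lb z by rewrite divr_ge0 // sumr_ge0.
have key : D / 4 <= \sum_z w z * (a0 z + Lb z * a1 z).
  have LbE : \sum_z w z * Lb z = 1.
    rewrite /Lb; under eq_bigr do rewrite mulrA mulr_sumr.
    rewrite -mulr_suml exchange_big /=.
    under eq_bigr do rewrite L1.
    by rewrite sumr_const -[1 *+ _]mulr_natl mulr1 divff // gt_eqF.
  have Lb2 : \sum_z w z * Lb z ^+ 2 <= 3 / 2.
    have -> : \sum_z w z * Lb z ^+ 2 =
      (\sum_f \sum_f' \sum_z w z * (L f z * L f' z)) / #|F|%:R ^+ 2.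
      under [X in _ = X / _]eq_bigr do rewrite exchange_big /=.
      rewrite exchange_big /= mulr_suml; apply: eq_bigr => z _.
      rewrite /Lb expr_div_n mulrA; congr (_ / _).
      rewrite expr2 big_distrlr /= mulr_sumr; apply: eq_bigr => f _.
      by rewrite mulr_sumr.
    by rewrite ler_pdivrMr ?exprn_gt0.
  (* As [Lb] has mean 1 and second moment at most [3 / 2], the mean of the bracket is at least
     [3 / 4 - 1 / 2]. *)
  apply: (@le_trans _ _ (\sum_z w z * ((3 / 4 - (1 - Lb z) ^+ 2) * D))).
    have -> : \sum_z w z * ((3 / 4 - (1 - Lb z) ^+ 2) * D) =
      ((3 / 4 - 1) * \sum_z w z + 2 * (\sum_z w z * Lb z)
        - \sum_z w z * Lb z ^+ 2) * D.
      rewrite !mulr_sumr -big_split -sumrB mulr_suml; apply: eq_bigr => z _ /=; ring.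
    rewrite w1 LbE; nra.
  apply: ler_sum => z _; apply: ler_wpM2l => //.
  have := Lb0 z; have := Da z; have := a00 z; have := a10 z.
  move: (Lb z) (a0 z) (a1 z) => l x y y0 x0 Dxy l0.
  have [l1|l1] := leP l 1.
  - have : (3 / 4 - (1 - l) ^+ 2) * D <= l * D.
      by apply: ler_wpM2r => //; have := sqr_ge0 (l - 1 / 2); lra.
    nra.
  - have : (3 / 4 - (1 - l) ^+ 2) * D <= 1 * D.
      by apply: ler_wpM2r => //; have := sqr_ge0 (1 - l); lra.
    nra.
apply/not_existsP => H.
have H0 : \sum_z w z * a0 z < D / 8.
  by have := H None; move/negP; rewrite -ltNge.
have Hf f : \sum_z w z * (L f z * a1 z) < D / 8.
  by have := H (Some f); move/negP; rewrite -ltNge.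
suff : \sum_z w z * (Lb z * a1 z) <= D / 8.
  move: key; under eq_bigr do rewrite mulrDr.
  by rewrite big_split /=; lra.
have -> : \sum_z w z * (Lb z * a1 z) =
    (\sum_f \sum_z w z * (L f z * a1 z)) / #|F|%:R.
  rewrite exchange_big /= mulr_suml; apply: eq_bigr => z _.
  rewrite /Lb mulrAC mulrA; congr (_ / _).
  by rewrite mulr_suml mulr_sumr.
rewrite ler_pdivrMr // mulr_natr -sumr_const; apply: ler_sum => f _.
exact: ltW.
Qed.

(** * Mixtures of spike configurations and the bound for theta *)

Section Blocks.
Context (R : realType) (P s m : nat) (pos : 'I_s * 'I_m -> 'I_P).
Hypothesis pos_inj : injective pos.

Definition block_set (f : {ffun 'I_s -> 'I_m}) : {set 'I_P} :=
  [set pos (b, f b) | b : 'I_s]%SET.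

Lemma card_block_setI (f g : {ffun 'I_s -> 'I_m}) :
  #|block_set f :&: block_set g| = (\sum_b (f b == g b))%N.
Proof.
have -> : block_set f :&: block_set g =
    [set pos (b, f b) | b in [set b | f b == g b]%SET]%SET.
  apply/finset.setP => j; rewrite inE; apply/andP/imsetP => [[/imsetP[b _ ->]]|[b]].
    case/imsetP => b' _ /pos_inj[bb fg]; exists b => //.
    by rewrite inE fg bb.
  rewrite inE => /eqP fg ->; split; apply/imsetP; exists b => //.
  by rewrite fg.
rewrite card_imset; last by move=> b b' /pos_inj[].
rewrite -sum1_card big_mkcond; apply: eq_bigr => b _; rewrite inE.
by case: (_ == _).
Qed.

Lemma card_block_set f : #|block_set f| = s.
Proof. by rewrite card_imset ?card_ord // => b b' /pos_inj[]. Qed.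

(** Two uniform choices agree in each block independently with probability [1 / m], so the mean of
    [G] to the overlap is [(1 + (G - 1) / m) ^ s], at most [expR (1 / 4)]. *)
Lemma sum_block_overlap (G : R) : (0 < m)%N -> 1 <= G ->
  s%:R * (G - 1) / m%:R <= 1 / 4 ->
  \sum_f \sum_g G ^+ #|block_set f :&: block_set g| <=
    3 / 2 * #|{ffun 'I_s -> 'I_m}|%:R ^+ 2.
Proof.
move=> m0 G1 sG; have m0' : 0 < m%:R :> R by rewrite ltr0n.
have -> : \sum_f \sum_g G ^+ #|block_set f :&: block_set g| =
    m%:R ^+ s * (m%:R + (G - 1)) ^+ s.
  have <- : #|{ffun 'I_s -> 'I_m}|%:R = m%:R ^+ s :> R.
    by rewrite card_ffun !card_ord natrX.
  rewrite mulr_natl -sumr_const; apply: eq_bigr => f _.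
  under eq_bigr do rewrite card_block_setI -prodrXr.
  rewrite -(bigA_distr_bigA (fun b i => G ^+ (f b == i))) /=.
  transitivity (\prod_(b < s) (m%:R + (G - 1))); last by rewrite prodr_const card_ord.
  apply: eq_bigr => b _.
  rewrite (bigD1 (f b)) //= eqxx expr1.
  rewrite (eq_bigr (fun=> 1)) => [|i]; last by rewrite eq_sym => /negbTE ->.
  rewrite sumr_const cardC1 card_ord.
  have -> : m%:R = m.-1%:R + 1 :> R by rewrite natr1 prednK.
  by ring.
rewrite card_ffun !card_ord natrX expr2 mulrCA.
rewrite ler_pM2l ?exprn_gt0 //.
have -> : m%:R + (G - 1) = m%:R * (1 + (G - 1) / m%:R) by field; rewrite gt_eqF.
rewrite exprMn [3 / 2 * _]mulrC ler_pM2l ?exprn_gt0 //.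
apply: (@le_trans _ _ (expR (s%:R * ((G - 1) / m%:R)))).
  rewrite expRM_natl; apply: lerXn2r; rewrite ?nnegrE ?expR_ge0 ?expR_ge1Dx //.
  by rewrite addr_ge0 // divr_ge0 ?subr_ge0 // ltW.
apply: (@le_trans _ _ (expR (1 / 4))); first by rewrite ler_expR mulrA.
rewrite -[1 / 4]opprK expRN invf_ple ?posrE ?expR_gt0 //.
by apply: le_trans (expR_ge1Dx _); lra.
Qed.

End Blocks.

Section ThetaLower.
Context (R : realType) (P N : nat) (lg : bool) (A c1 : R) (k : 'I_P -> R).
Context (n : nat) (nu q cL cU rad tau : R).
Context (s m : nat) (pos : 'I_s * 'I_m -> 'I_P) (D : R).
Hypotheses (N_gt1 : (1 < N)%N) (A1 : ~~ lg -> A = 1)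
  (c1_gt0 : 0 < c1) (nu_ge : Num.sqrt 2 <= nu)
  (pos_inj : injective pos) (m_gt0 : (0 < m)%N) (D_ge0 : 0 <= D).
Local Notation J := (block_set pos).
Local Notation HqJ J :=
  (Hq q cL cU rad tau (model_mean N lg A c1 k J) (model_cov N lg c1 k J)).

Lemma minimax_theta_ge :
  HqJ finset.set0 -> (forall f, HqJ (J f)) ->
  (forall f, D <= A ^+ 2 * (snr N k (J f) - snr N k finset.set0)) ->
  s%:R * ((1 + N%:R^-1 : R) ^+ n - 1) / m%:R <= 1 / 4 ->
  ((D / 8)%:E <= minimax_theta n P.+1 q cL cU nu rad tau)%E.
Proof.
move=> H0 HJ gap G_le.
pose th J := theta_of (model_mean N lg A c1 k J) (model_cov N lg c1 k J).
rewrite /minimax_theta.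
apply: (minimax_risk_ge (A := A) (lg := lg) (k := k) N_gt1 c1_gt0 nu_ge _
  (J := fun o : option {ffun 'I_s -> 'I_m} => if o is Some f then J f else finset.set0)).
- move=> mu Sigma; apply: measurableT_comp => //.
  by apply: measurable_funB.
- by case.
move=> est.
(* One-sided losses: they involve the alternatives only through the common gap [D], so the values of
   theta in the mixture need not coincide. *)
pose a0 z := Num.max 0 (est z - th finset.set0).
pose a1 z := Num.max 0 (th finset.set0 + D - est z).
have G1 : 1 <= (1 + N%:R^-1 : R) ^+ n by rewrite exprn_ege1 // lerDl invr_ge0.
have m0 : (0 < #|{ffun 'I_s -> 'I_m}|)%N by rewrite card_ffun !card_ord expn_gt0 m_gt0.
pose L f z := \prod_(j in J f) @sample_lr R P N lg n j z.
have LE f z : sample_wt R lg finset.set0 z * L f z = sample_wt R lg (J f) z.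
  by rewrite -sample_wtE.
have L0 f z : 0 <= L f z.
  apply: prodr_ge0 => j _; apply: prodr_ge0 => i _.
  by apply: tilt_ge0; rewrite ?factor_norm.
have L1 f : \sum_z sample_wt R lg finset.set0 z * L f z = 1.
  by under eq_bigr do rewrite LE; exact: sample_wt_sum.
have L2 : \sum_f \sum_f' \sum_z sample_wt R lg finset.set0 z * (L f z * L f' z) <=
    3 / 2 * #|{ffun 'I_s -> 'I_m}|%:R ^+ 2.
  under eq_bigr do under eq_bigr do rewrite sample_lr_cross //.
  exact: sum_block_overlap.
have a00 z : 0 <= a0 z by rewrite /a0 le_max lexx.
have a10 z : 0 <= a1 z by rewrite /a1 le_max lexx.
have aD z : D <= a0 z + a1 z.
  rewrite /a0 /a1; move: (th _) (est z) => x y.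
  by case: (leP 0 (y - x)) => ?; case: (leP 0 (x + D - y)) => ?; lra.
have [x xD] := fuzzy_two_point m0 (sample_wt_ge0 R lg N_gt1 _)
  (sample_wt_sum R lg n N_gt1 _) L0 L1 L2 a00 a10 D_ge0 aD.
exists x; apply: le_trans xD _; apply: ler_sum => z _.
case: x => [f|].
- rewrite mulrA LE; apply: ler_wpM2l; first exact: sample_wt_ge0.
  have := gap f; rewrite -/(th _) /a1 => gapf.
  have : th finset.set0 + D <= th (J f).
    rewrite /th !model_thetaE //; lra.
  rewrite ge_max normr_ge0 /= => h.
  by rewrite distrC; apply: le_trans (ler_norm _); lra.
- apply: ler_wpM2l; first exact: sample_wt_ge0.
  by rewrite /a0 ge_max normr_ge0 /= ler_norm.
Qed.
End ThetaLower.

(* The events [T x] that [y] is close to the [x]-th mean are disjoint, and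
   [L 1_T <= (lam L^2 + 1_T / lam) / 2] bounds their probabilities. *)
Lemma many_hypotheses (R : realType) (Z : finType) (m : nat) (w : Z -> R)
    (L : option 'I_m -> Z -> R) (y : Z -> 'I_m -> R) (kap : R) :
  (forall z, 0 <= w z) -> \sum_z w z = 1 -> (forall x z, 0 <= L x z) ->
  (forall x, \sum_z w z * L x z = 1) ->
  (forall x, \sum_z w z * L x z ^+ 2 <= 9 / 16 * m.+1%:R) ->
  kap ^+ 2 * m.+1%:R / 16 <=
    \sum_x \sum_z w z * (L x z * \sum_i (y z i - kap * (x == Some i)%:R) ^+ 2).
Proof.
move=> w0 w1 L0 L1 L2.
have M0 : 0 < m.+1%:R :> R by rewrite ltr0n.
pose dist x z := \sum_i (y z i - kap * (x == Some i)%:R) ^+ 2.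
have [->|k0] := eqVneq kap 0.
  rewrite expr0n !mul0r; apply: sumr_ge0 => x _; apply: sumr_ge0 => z _.
  by rewrite mulr_ge0 // mulr_ge0 // sumr_ge0 // => i _; exact: sqr_ge0.
have k2 : 0 < kap ^+ 2 by rewrite exprn_even_gt0.
pose T x z := dist x z < kap ^+ 2 / 4.
(* Two distinct means differ by [kap] in some coordinate, so the squared distances to them add up to
   at least [kap ^ 2 / 2]. *)
have disj z : \sum_x (T x z)%:R <= 1 :> R.
  have [[x Tx]|noT] := pselect (exists x, T x z); last first.
    rewrite big1 // => x _; case: (boolP (T x z)) => // Tx.
    by exfalso; apply: noT; exists x.
  rewrite (bigD1 x) //= [X in _ + X]big1 ?addr0 ?lern1 ?leq_b1 // => x' xx'.
  case: (boolP (T x' z)) => // Tx'; exfalso.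
  have : kap ^+ 2 <= 2 * dist x z + 2 * dist x' z.
    rewrite /dist !mulr_sumr -big_split /=.
    have [i xi] : exists i, (x == Some i) != (x' == Some i).
      case: x x' xx' {Tx Tx'} => [i|] [i'|] // ii'.
      - by exists i; rewrite eqxx (negbTE ii').
      - by exists i; rewrite eqxx.
      - by exists i'; rewrite eqxx.
    rewrite (bigD1 i) //=; apply: ler_wpDr.
      by apply: sumr_ge0 => i' _; rewrite addr_ge0 // mulr_ge0 ?sqr_ge0.
    set u := y z i; move: xi; case: (x == _); case: (x' == _) => //= _.
    - rewrite ?mulr1 ?mulr0 subr0.
      have := sqr_ge0 (u - kap / 2); lra.
    - rewrite ?mulr1 ?mulr0 subr0.
      have := sqr_ge0 (u - kap / 2); lra.
  by move: Tx Tx'; rewrite /T; lra.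
have step x : \sum_z w z * (L x z * dist x z) >=
    kap ^+ 2 / 4 * (1 - \sum_z w z * (L x z * (T x z)%:R)).
  rewrite -[X in X - _](L1 x) -sumrB mulr_sumr; apply: ler_sum => z _.
  rewrite -mulrBr mulrCA; apply: ler_wpM2l => //.
  rewrite -[X in X - _]mulr1 -mulrBr mulrCA; apply: ler_wpM2l => //.
  case: (boolP (T x z)) => [_|]; first by rewrite subrr mulr0 sumr_ge0 // => i _; exact: sqr_ge0.
  by rewrite -leNgt subr0 mulr1.
(* The minimizer of [lam / 2 * (9 / 16 * m.+1 ^ 2) + 1 / (2 * lam)], whose minimum is
   [3 / 4 * m.+1]; a quarter of the total mass is left for the error. *)
pose lam : R := 4 / 3 / m.+1%:R.
have lam0 : 0 < lam by rewrite divr_gt0.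
have bound : \sum_x \sum_z w z * (L x z * (T x z)%:R) <= 3 / 4 * m.+1%:R.
  apply: (@le_trans _ _ (\sum_x \sum_z w z * (lam / 2 * L x z ^+ 2 + (T x z)%:R / (2 * lam)))).
    apply: ler_sum => x _; apply: ler_sum => z _; apply: ler_wpM2l => //.
    case: (T x z); last first.
      by rewrite mulr0 mul0r addr0 mulr_ge0 ?sqr_ge0 // ltW // divr_gt0.
    rewrite mulr1 -subr_ge0.
    have -> : lam / 2 * L x z ^+ 2 + 1 / (2 * lam) - L x z = (lam * L x z - 1) ^+ 2 / (2 * lam).
      by field; rewrite gt_eqF.
    by apply: divr_ge0; [exact: sqr_ge0|rewrite mulr_ge0 //; exact: ltW].
  have -> : \sum_x \sum_z w z * (lam / 2 * L x z ^+ 2 + (T x z)%:R / (2 * lam)) =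
    lam / 2 * (\sum_x \sum_z w z * L x z ^+ 2) +
    (\sum_z w z * \sum_x (T x z)%:R) / (2 * lam).
    rewrite [X in _ + X / _](eq_bigr (fun z => \sum_x w z * (T x z)%:R)); last first.
      by move=> z _; rewrite mulr_sumr.
    rewrite [X in _ + X / _]exchange_big /= mulr_sumr mulr_suml -big_split.
    apply: eq_bigr => x _ /=; rewrite mulr_sumr mulr_suml -big_split.
    by apply: eq_bigr => z _ /=; ring.
  have B1 : \sum_x \sum_z w z * L x z ^+ 2 <= m.+1%:R * (9 / 16 * m.+1%:R).
    apply: (@le_trans _ _ (\sum_(x : option 'I_m) 9 / 16 * m.+1%:R)); first exact: ler_sum.
    by rewrite sumr_const card_option card_ord -[_ *+ m.+1]mulr_natl.
  have B2 : \sum_z w z * \sum_x (T x z)%:R <= 1.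
    rewrite -[X in _ <= X]w1; apply: ler_sum => z _.
    by rewrite -[X in _ <= X]mulr1; apply: ler_wpM2l.
  apply: (@le_trans _ _ (lam / 2 * (m.+1%:R * (9 / 16 * m.+1%:R)) + 1 / (2 * lam))).
    apply: lerD; first by apply: ler_wpM2l => //; rewrite ltW // divr_gt0.
    by apply: ler_wpM2r => //; rewrite invr_ge0 mulr_ge0 // ltW.
  rewrite le_eqVlt; apply/orP; left; apply/eqP.
  by rewrite /lam; field; rewrite gt_eqF.
apply: (@le_trans _ _ (\sum_x kap ^+ 2 / 4 * (1 - \sum_z w z * (L x z * (T x z)%:R)))).
  rewrite -mulr_sumr sumrB sumr_const card_option card_ord; nra.
by apply: ler_sum => x _; exact: step.
Qed.

(** * Block-by-block comparison and the bound for alpha *)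

Section Update.
Context (R : realType) (I O : finType).

Definition upd (f : {ffun I -> O}) b x : {ffun I -> O} :=
  [ffun b' => if b' == b then x else f b'].

(** Exchanging [x] with the value at [b] is an involution on pairs: resampling one block of a
    uniform configuration leaves it uniform. *)
Lemma sum_upd (F : {ffun I -> O} -> R) b :
  \sum_f \sum_x F (upd f b x) = #|O|%:R * \sum_f F f.
Proof.
rewrite pair_bigA /=.
have invol : involutive (fun fx : {ffun I -> O} * O => (upd fx.1 b fx.2, fx.1 b)).
  move=> [f x] /=; congr pair; last by rewrite ffunE eqxx.
  by apply/ffunP => b'; rewrite !ffunE; case: eqP => [->|].
rewrite (reindex_inj (inv_inj invol)) /=.
rewrite (eq_bigr (fun fx => F fx.1)) => [|[f x] _]; last first.
  by congr F; have [] := invol (f, x).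
rewrite -(pair_bigA _ (fun f _ => F f)) /= mulr_sumr; apply: eq_bigr => f _.
by rewrite sumr_const mulr_natl.
Qed.
End Update.

Section PartialBlocks.
Context (P s m : nat) (pos : 'I_s * 'I_m -> 'I_P).
Hypothesis pos_inj : injective pos.

Definition pblock_set (f : {ffun 'I_s -> option 'I_m}) : {set 'I_P} :=
  [set j | [exists b, exists i, (f b == Some i) && (pos (b, i) == j)]]%SET.

Lemma pos_pblock f b i : (pos (b, i) \in pblock_set f) = (f b == Some i).
Proof.
rewrite inE; apply/existsP/idP => [[b' /existsP[i' /andP[fb /eqP/pos_inj[<- <-]]]]//|fb].
by exists b; apply/existsP; exists i; rewrite fb eqxx.
Qed.

Lemma pblock_upd f b i : pblock_set (upd f b (Some i)) =
  (pos (b, i) |: pblock_set (upd f b None))%SET.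
Proof.
apply/finset.setP => j; rewrite finset.in_setU1; apply/idP/idP.
  rewrite inE => /existsP[b' /existsP[i' /andP[fb /eqP <-]]].
  rewrite pos_pblock; move: fb; rewrite !ffunE; case: (eqVneq b' b) => [->|_ ->].
    by move=> /eqP[->]; rewrite eqxx.
  by rewrite orbT.
case/orP => [/eqP->|]; first by rewrite pos_pblock ffunE eqxx.
rewrite inE => /existsP[b' /existsP[i' /andP[fb /eqP <-]]].
by rewrite pos_pblock; move: fb; rewrite !ffunE; case: (eqVneq b' b).
Qed.

Lemma card_pblock_set f : (#|pblock_set f| <= s)%N.
Proof.
apply: (@leq_trans #|[set (if f b is Some i then Some (pos (b, i)) else None) | b : 'I_s]%SET|).
  rewrite -(card_imset (pblock_set f) (@Some_inj _)); apply/subset_leq_card/fintype.subsetP => _ /imsetP[j + ->].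
  rewrite inE => /existsP[b /existsP[i /andP[/eqP fb /eqP <-]]].
  by apply/imsetP; exists b; rewrite // fb.
by rewrite (leq_trans (leq_imset_card _ _)) // card_ord.
Qed.
End PartialBlocks.

Section AlphaLower.
Context (R : realType) (P N : nat) (lg : bool) (A c1 : R).
Context (n : nat) (nu q cL cU rad tau : R).
Context (s m : nat) (pos : 'I_s * 'I_m -> 'I_P).
Hypotheses (N_gt1 : (1 < N)%N) (A1 : ~~ lg -> A = 1)
  (c1_gt0 : 0 < c1) (nu_ge : Num.sqrt 2 <= nu) (pos_inj : injective pos).
Local Notation k0 := (fun _ : 'I_P => 0 : R).
Local Notation J := (pblock_set pos).
Local Notation HqJ J :=
  (Hq q cL cU rad tau (model_mean N lg A c1 k0 J) (model_cov N lg c1 k0 J)).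

(** The entry of alpha at a replaced coordinate, up to sign, when [k] is zero. *)
Definition spike : R := A / (noise_scale N c1 * (N%:R - 1)).

Lemma lqnorm2_sum p (v : 'cV[R]_p) : lqnorm 2 v ^+ 2 = \sum_i v i 0 ^+ 2.
Proof.
by rewrite lqnorm2_sqr mxE; apply: eq_bigr => i _; rewrite mxE -expr2.
Qed.

Let spike_alpha f b i : (if lg then -1 else 1) *
    model_alpha N lg A c1 k0 (J f) (lift ord0 (pos (b, i))) 0 =
  spike * (f b == Some i)%:R.
Proof.
rewrite cons_colS /loading pos_pblock // add0r /spike.
case: (f b == Some i); last by rewrite mul0r !mulr0.
by case: lg; rewrite ?mulN1r ?mulNr ?opprK div1r mulr1 ?mul1r.
Qed.

Let loss_ge (a : P.+1.-tuple R) (f : {ffun 'I_s -> option 'I_m}) :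
  \sum_b \sum_i ((if lg then -1 else 1) * tnth a (lift ord0 (pos (b, i)))
    - spike * (f b == Some i)%:R) ^+ 2 <=
  lqnorm 2 (vec a - alpha_of (model_mean N lg A c1 k0 (J f))
                             (model_cov N lg c1 k0 (J f))) ^+ 2.
Proof.
rewrite lqnorm2_sum model_alphaE // big_ord_recl; apply: ler_wpDl; first exact: sqr_ge0.
rewrite pair_bigA /=.
pose F j := ((vec a - model_alpha N lg A c1 k0 (J f)) (lift ord0 j) 0) ^+ 2.
apply: (@le_trans _ _ (\sum_x F (pos x))).
  apply: ler_sum => -[b i] _ /=; rewrite -spike_alpha -mulrBr exprMn /F.
  rewrite [X in _ <= X ^+ 2]mxE [vec a _ _]mxE [X in _ <= (_ + X) ^+ 2]mxE.
  by case: lg; rewrite ?sqrrN expr1n mul1r.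
have -> : \sum_x F (pos x) = \sum_(j in [set pos x | x in [set: 'I_s * 'I_m]]%SET) F j.
  rewrite big_imset /=; last by move=> x y _ _; exact: pos_inj.
  by apply: eq_bigl => x; rewrite finset.in_setT.
rewrite [X in X <= _]big_mkcond; apply: ler_sum => j _.
by case: ifP => // _; exact: sqr_ge0.
Qed.

(** An Assouad argument with blocks in place of bits: the squared loss splits over the blocks, and
    the average over all configurations bounds the worst one from below. *)
Lemma minimax_alpha_ge : (forall f, HqJ (J f)) ->
  (1 + N%:R^-1 : R) ^+ n <= 9 / 16 * m.+1%:R ->
  ((s%:R * spike ^+ 2 / 16)%:E <= minimax_alpha n P.+1 q cL cU nu rad tau)%E.
Proof.
move=> HJ G_le; rewrite /minimax_alpha.
apply: (minimax_risk_ge (A := A) (lg := lg) (k := k0) N_gt1 c1_gt0 nu_ge _ (J := J)) => //.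
  move=> mu Sigma; under eq_fun do rewrite lqnorm2_sum.
  apply: measurable_sum => i; apply: measurable_funX.
  under eq_fun do rewrite mxE [vec _ _ _]mxE.
  by apply: measurable_funD => //; exact: measurable_tnth.
move=> est.
have G1 : 1 <= (1 + N%:R^-1 : R) ^+ n by rewrite exprn_ege1 // lerDl invr_ge0.
pose W f (z : {ffun 'I_n -> latent P N}) : R := sample_wt R lg (J f) z.
pose y b (z : {ffun 'I_n -> latent P N}) i : R :=
  (if lg then -1 else 1) * tnth (est z) (lift ord0 (pos (b, i))).
pose r b f := \sum_z W f z * \sum_i (y b z i - spike * (f b == Some i)%:R) ^+ 2.
(* The average over configurations may be taken over the [m.+1] contents of block [b] first, with
   the others fixed. Likelihood ratios are relative to the configuration in which block [b] is
   empty. *)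
have rb b : spike ^+ 2 / 16 * #|{ffun 'I_s -> option 'I_m}|%:R <= \sum_f r b f.
  rewrite -(ler_pM2l (_ : 0 < m.+1%:R)) ?ltr0n //.
  have -> : m.+1%:R * \sum_f r b f = \sum_f \sum_x r b (upd f b x).
    by rewrite sum_upd card_option card_ord.
  rewrite mulrCA -[X in _ * (_ * X)]sumr_const !mulr_sumr; apply: ler_sum => f _.
  pose L x (z : {ffun 'I_n -> latent P N}) : R := if x is Some i then sample_lr R lg (pos (b, i)) z else 1.
  have WL x z : W (upd f b x) z = W (upd f b None) z * L x z.
    case: x => [i|]; last by rewrite mulr1.
    by rewrite /W /L pblock_upd // sample_wt_setU1 // pos_pblock // ffunE eqxx.
  have L0 x z : 0 <= L x z.
    case: x => //= i; apply: prodr_ge0 => j _.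
    by apply: tilt_ge0; rewrite ?factor_norm.
  have L1 x : \sum_z W (upd f b None) z * L x z = 1.
    by under eq_bigr do rewrite -WL; exact: sample_wt_sum.
  have L2 x : \sum_z W (upd f b None) z * L x z ^+ 2 <= 9 / 16 * m.+1%:R.
    case: x => [i|].
      by rewrite sample_lr_sqr // pos_pblock // ffunE eqxx.
    under eq_bigr do rewrite expr1n mulr1.
    by rewrite sample_wt_sum //; exact: le_trans G_le.
  have := many_hypotheses (y b) spike (sample_wt_ge0 R lg N_gt1 _)
    (sample_wt_sum R lg n N_gt1 _) L0 L1 L2.
  rewrite [X in X <= _ -> _]mulrAC mulr1 => h; apply: le_trans h _.
  rewrite le_eqVlt; apply/orP; left; apply/eqP.
  apply: eq_bigr => x _; apply: eq_bigr => z _.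
  by rewrite WL mulrA ffunE eqxx.
apply/not_existsP => H.
have : \sum_f \sum_b r b f < \sum_(f : {ffun 'I_s -> option 'I_m}) s%:R * spike ^+ 2 / 16.
  apply: ltr_sum; first by apply/hasP; exists [ffun=> None]; rewrite ?mem_index_enum.
  move=> f _; have := H f; move/negP; rewrite -ltNge; apply: le_lt_trans.
  rewrite exchange_big /=; apply: ler_sum => z _; rewrite -mulr_sumr.
  by apply: ler_wpM2l; [exact: sample_wt_ge0|exact: loss_ge].
apply/negP; rewrite -leNgt exchange_big sumr_const /=.
apply: (@le_trans _ _ (\sum_(b < s) spike ^+ 2 / 16 * #|{ffun 'I_s -> option 'I_m}|%:R)).
  rewrite sumr_const card_ord -mulr_natl -[X in _ <= X]mulr_natl le_eqVlt.
  by apply/orP; left; apply/eqP; ring.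
by apply: ler_sum => b _.
Qed.
End AlphaLower.

(** * Choice of the parameters *)

Section Feasible.
Context (R : realType) (q cL cU c1 eta kap : R).
Hypotheses (q_gt0 : 0 < q) (cL_gt0 : 0 < cL) (cL_lt_cU : cL < cU)
  (c1E : c1 = (cL + cU) / 2) (etaE : eta = (c1 - cL) / (2 * c1))
  (kap_gt0 : 0 < kap) (kap_le : kap <= 1 / 2)
  (kap_q : (16 * kap * Num.max 1 cU / c1) `^ (q / 2) <= 1 / 2).

Let q2 : 0 < q / 2. Proof. by rewrite divr_gt0. Qed.
Let c1_gt0 : 0 < c1.
Proof. by rewrite c1E divr_gt0 // addr_gt0 //; exact: lt_trans cL_lt_cU. Qed.

(** For [T > 1], theta is [A ^ 2 * (1 + snr)] and has to be of order [T]; the factor [kap] leaves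
    room for the first entry of alpha within [rad]. For [T <= 1], theta is [snr] itself. *)
Definition amplitude (T : R) : R := if 1 < T then Num.sqrt (kap * T) else 1.

Lemma amplitude_ge0 T : 0 <= amplitude T.
Proof. by rewrite /amplitude; case: ifP => // _; exact: sqrtr_ge0. Qed.

Lemma amplitude_sqr T : 0 < T ->
  kap * Num.max 1 T <= amplitude T ^+ 2 <= Num.max 1 T.
Proof.
move=> T0; have kT : 0 <= kap * T by rewrite mulr_ge0 // ltW.
have k1 : kap <= 1 by apply: le_trans kap_le _; lra.
rewrite /amplitude; have [T1|T1] := ltP 1 T.
  by rewrite (sqr_sqrtr kT) lexx /= -[leRHS]mul1r ler_wpM2r // ltW.
by rewrite expr1n mulr1 lexx andbT.
Qed.

Lemma sqr_powR_half (x : R) : 0 <= x -> x `^ q = (x ^+ 2) `^ (q / 2).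
Proof.
move=> x0; rewrite -powR_mulrn // -powRrM; congr (_ `^ _).
by rewrite mulrCA divff ?mulr1.
Qed.

(** Common form of the radius checks: [z] is the square of an entry of alpha, and [kap_q] makes the
    numerical constants cost a factor of at most [1 / 2]. *)
Lemma powR_scale (rad T z : R) : 0 <= z -> 0 < T -> 0 < rad ->
  z <= 16 * kap * Num.max 1 cU / c1 * T -> T `^ (q / 2) <= rad ->
  z `^ (q / 2) <= rad / 2.
Proof.
move=> z0 T0 rad0 zT Trad.
have C0 : 0 <= 16 * kap * Num.max 1 cU / c1.
  by rewrite !mulr_ge0 ?invr_ge0 ?le_max ?ler01 ?(ltW kap_gt0) ?(ltW c1_gt0).
apply: (@le_trans _ _ ((16 * kap * Num.max 1 cU / c1 * T) `^ (q / 2))).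
  by apply: ge0_ler_powR; rewrite ?nnegrE ?(ltW q2) //; apply: mulr_ge0; rewrite ?(ltW T0).
rewrite powRM ?(ltW T0) // mulrC.
by apply: ler_pM; rewrite ?powR_ge0 // -[leRHS]mul1r.
Qed.

Variables (P N : nat) (T rad tau : R) (k : 'I_P -> R).
Hypotheses (N_gt1 : (1 < N)%N) (k_ge0 : forall j, 0 <= k j)
  (N_eta : N%:R^-1 <= eta) (T_gt0 : 0 < T) (T_tau : T <= tau)
  (rad_gt0 : 0 < rad) (T_rad : T <= cU * rad `^ (2 / q)).
Local Notation A := (amplitude T).

Lemma T_powR : (T / Num.max 1 cU) `^ (q / 2) <= rad.
Proof.
have m0 : 0 < Num.max 1 cU by rewrite lt_max ltr01.
apply: (@le_trans _ _ ((rad `^ (2 / q)) `^ (q / 2))).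
  apply: ge0_ler_powR; rewrite ?nnegrE ?powR_ge0 ?(ltW q2) ?divr_ge0 ?(ltW T_gt0) ?(ltW m0) //.
  rewrite ler_pdivrMr // mulrC; apply: le_trans T_rad _.
  by rewrite ler_wpM2r ?powR_ge0 // le_max lexx orbT.
have -> : (rad `^ (2 / q)) `^ (q / 2) = rad.
  rewrite -powRrM mulrA mulfVK ?gt_eqF // divff // powRr1 //; exact: ltW.
exact: lexx.
Qed.

(** Half of the radius is reserved for the first entry of alpha, half for the others. *)
Lemma model_feasible (J : {set 'I_P}) :
  snr N k J <= eta ^+ 2 -> snr N k J <= Num.min T 1 / 2 ->
  \sum_j (A * (loading k J j / (noise_scale N c1 * (N%:R - (j \in J)%:R)))) `^ q <= rad / 2 ->
  Hq q cL cU rad tau (model_mean N (1 < T) A c1 k J) (model_cov N (1 < T) c1 k J).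
Proof.
move=> snr_eta snr_T sum_le.
have snr0 := snr_ge0 k N_gt1 J.
have A0 := amplitude_ge0 T.
have A1 : ~~ (1 < T) -> A = 1 by rewrite /amplitude => /negbTE ->.
apply: (model_Hq N_gt1 A0 A1 c1_gt0 k_ge0 q_gt0 c1E cL_gt0 cL_lt_cU etaE N_eta snr_eta).
- apply: le_trans T_tau; rewrite /amplitude; have [T1|T1] := ltP 1 T.
    rewrite sqr_sqrtr /=; last by rewrite mulr_ge0 // ?(ltW kap_gt0) ?(ltW T_gt0).
    have : snr N k J <= 1 / 2.
      by apply: le_trans snr_T _; rewrite min_r //; exact: ltW.
    move=> s1; rewrite -[leRHS]mul1r mulrAC; apply: ler_wpM2r; first exact: ltW.
    rewrite mulr1n; apply: (@le_trans _ _ (1 / 2 * (1 + 1 / 2))); last lra.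
    by apply: ler_pM; rewrite ?(ltW kap_gt0) ?addr_ge0 // lerD2l.
  rewrite expr1n mul1r add0r; apply: le_trans snr_T _; rewrite min_l //; have := T_gt0; lra.
- rewrite [leRHS]splitr; apply: lerD => //.
  have [T1|T1] := ltP 1 T; last by rewrite mul0r divr_ge0 // ltW.
  rewrite mul1r sqr_powR_half; last by rewrite mulr_ge0 ?divr_ge0 ?sqrtr_ge0 ?addr_ge0.
  apply: (powR_scale (T := T / Num.max 1 cU)).
  + exact: sqr_ge0.
  + by rewrite divr_gt0 // lt_max ltr01.
  + exact: rad_gt0.
  + have m0 : Num.max 1 cU != 0 by rewrite gt_eqF // lt_max ltr01.
    rewrite /amplitude T1 !exprMn exprVn !sqr_sqrtr ?mulr_ge0 ?(ltW T_gt0) ?(ltW kap_gt0) ?(ltW c1_gt0) //.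
    have -> : 16 * kap * Num.max 1 cU / c1 * (T / Num.max 1 cU) = kap * T / c1 * 16.
      by field; rewrite m0 gt_eqF.
    apply: ler_wpM2l; first by rewrite divr_ge0 ?mulr_ge0 // ltW.
    have : snr N k J <= 1 / 2.
      by apply: le_trans snr_T _; rewrite min_r //; exact: ltW.
    nra.
  + exact: T_powR.
Qed.

(** The factor 2 bounds [N / (N - 1)]. *)
Lemma term_le (J : {set 'I_P}) j :
  (A * (loading k J j / (noise_scale N c1 * (N%:R - (j \in J)%:R)))) ^+ 2 <=
  2 / c1 * A ^+ 2 * (loading k J j ^+ 2 / (N%:R - (j \in J)%:R)).
Proof.
have N2 : 2 <= N%:R :> R by rewrite (ler_nat R 2).
have e1 : (j \in J)%:R <= 1 :> R by rewrite lern1 leq_b1.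
have N'0 : 0 < N%:R - (j \in J)%:R :> R by lra.
rewrite !exprMn exprVn exprMn sqr_sqrtr; last by rewrite divr_ge0 // ltW.
have -> : A ^+ 2 * (loading k J j ^+ 2 / (c1 / N%:R * (N%:R - (j \in J)%:R) ^+ 2)) =
   A ^+ 2 * (loading k J j ^+ 2 / (N%:R - (j \in J)%:R)) / c1 * (N%:R / (N%:R - (j \in J)%:R)).
  field; rewrite !gt_eqF //; lra.
have -> : 2 / c1 * A ^+ 2 * (loading k J j ^+ 2 / (N%:R - (j \in J)%:R)) =
   A ^+ 2 * (loading k J j ^+ 2 / (N%:R - (j \in J)%:R)) / c1 * 2.
  by field; rewrite !gt_eqF.
apply: ler_wpM2l.
  apply: divr_ge0; last exact: ltW.
  apply: mulr_ge0; first exact: sqr_ge0.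
  by apply: divr_ge0; [exact: sqr_ge0|exact: ltW].
by rewrite ler_pdivrMr //; lra.
Qed.

End Feasible.

Lemma nat_inv_exists (R : realType) (e : R) : 0 < e -> e <= 1 / 2 ->
  exists N : nat, [/\ (1 < N)%N, N%:R^-1 <= e & e / 2 <= N%:R^-1].
Proof.
move=> e0 e1; have ei0 : 0 <= e^-1 by rewrite invr_ge0 ltW.
have /andP[tle tgt] := truncn_itv ei0.
have e2 : 2 <= e^-1.
  by rewrite -[2]invrK lef_pV2 ?posrE ?invr_gt0 //; apply: le_trans e1 _; lra.
exists (Num.truncn e^-1).+1; split.
- rewrite -(ltr_nat R); apply: le_lt_trans tgt; lra.
- by rewrite -[leRHS]invrK lef_pV2 ?posrE ?invr_gt0 // ltW.
- rewrite -[leLHS]invrK lef_pV2 ?posrE ?invr_gt0 ?divr_gt0 //.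
  rewrite invf_div -natr1; lra.
Qed.

(** At least one spike is always used, even if [y < 1]; hence the separate case [s = 1] in the
    bounds that follow. *)
Lemma nat_floor_exists (R : realType) (y : R) : 0 <= y ->
  exists s : nat, [/\ (0 < s)%N, s = 1%N \/ s%:R <= y & y / 2 <= s%:R].
Proof.
move=> y0; have [y2|y2] := ltP y 2.
  by exists 1%N; split=> //; [left|lra].
have /andP[tle tgt] := truncn_itv y0.
exists (Num.truncn y); rewrite -natr1 in tgt; split.
- by rewrite -(ltr_nat R); apply: (@lt_le_trans _ _ 1) => //; lra.
- by right.
- lra.
Qed.

Lemma block_pos_exists (s m P : nat) : (s * m <= P)%N ->
  exists pos : 'I_s * 'I_m -> 'I_P, injective pos.
Proof.
move=> smP.
have bnd (x : 'I_s * 'I_m) : (x.1 * m + x.2 < P)%N.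
  apply: leq_trans smP; case: x => [[b bs] [i im]] /=; nia.
exists (fun x => Ordinal (bnd x)) => -[[b bs] [i im]] [[b' bs'] [i' im']] /=.
move=> /(congr1 val) /= E.
have m0 : (0 < m)%N by apply: leq_trans im.
have bb : b = b' by have := congr1 (divn^~ m) E; rewrite /= !divnMDl // !divn_small // !addn0.
have ii : i = i' by move: E; rewrite bb => /addnI.
by congr pair; apply: val_inj.
Qed.

Lemma onepV_exp_le (R : realType) (N n : nat) :
  (1 + N%:R^-1 : R) ^+ n <= expR (n%:R / N%:R).
Proof.
rewrite expRM_natl; apply: lerXn2r; rewrite ?nnegrE ?expR_ge0 ?addr_ge0 ?invr_ge0 //.
exact: expR_ge1Dx.
Qed.

Lemma snr_spikes (R : realType) (P N : nat) (J : {set 'I_P}) :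
  snr N (fun=> 0 : R) J = #|J|%:R / (N%:R - 1).
Proof.
rewrite /snr (bigID (fun j => j \in J)) /= [X in _ + X]big1 ?addr0 => [|j /negbTE jJ]; last first.
  by rewrite /loading jJ addr0 expr2 mul0r mul0r.
rewrite (eq_bigr (fun=> (N%:R - 1)^-1)) => [|j jJ].
  by rewrite sumr_const mulr_natl.
by rewrite /loading jJ add0r expr1n mul1r.
Qed.

Section Sparse.
Context (R : realType) (q cL cU c1 eta kap : R).
Hypotheses (q_gt0 : 0 < q) (cL_gt0 : 0 < cL) (cL_lt_cU : cL < cU)
  (c1E : c1 = (cL + cU) / 2) (etaE : eta = (c1 - cL) / (2 * c1))
  (kap_gt0 : 0 < kap) (kap_le : kap <= 1 / 4) (kap_eta : kap <= eta)
  (kap_eta2 : 2 * kap <= eta ^+ 2)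
  (kap_q : (16 * kap * Num.max 1 cU / c1) `^ (q / 2) <= 1 / 2).
Variables (P : nat) (T L S y1 rad tau : R).
Hypotheses (T_gt0 : 0 < T) (T_tau : T <= tau) (rad_gt0 : 0 < rad)
  (T_rad : T <= cU * rad `^ (2 / q)) (L_gt0 : 0 < L) (S_gt0 : 0 < S)
  (S_rad : S * (Num.max 1 T * L) `^ (q / 2) <= rad)
  (y1_gt0 : 0 < y1) (y1_le1 : y1 <= 1).
Local Notation k0 := (fun _ : 'I_P => 0 : R).

Lemma sparse_setting : exists N s : nat,
  [/\ (1 < N)%N, (0 < s)%N, s = 1%N \/ s%:R <= y1 * S &
   [/\ N%:R^-1 <= kap * L,
      kap * y1 / 4 * Num.min (Num.min T 1) (S * L) <= s%:R / N%:R &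
      forall J : {set 'I_P}, (#|J| <= s)%N ->
        Hq q cL cU rad tau
          (model_mean N (1 < T) (amplitude kap T) c1 k0 J)
          (model_cov N (1 < T) c1 k0 J)]].
Proof.
have c1_gt0 : 0 < c1 by rewrite c1E divr_gt0 // addr_gt0 //; exact: lt_trans cL_lt_cU.
have kap2 : kap <= 1 / 2 by apply: le_trans kap_le _; lra.
pose T1 := Num.min T 1; pose M := Num.max 1 T.
have T1_gt0 : 0 < T1 by rewrite lt_min T_gt0 ltr01.
have T1_le1 : T1 <= 1 by rewrite ge_min lexx orbT.
have M_ge1 : 1 <= M by rewrite le_max lexx.
have M_gt0 : 0 < M by apply: lt_le_trans M_ge1.
have MT1 : M * T1 = T.
  by rewrite /M /T1; case: (leP T 1) => _; rewrite ?mul1r ?mulr1.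
(* [1 / N] is of order [mu]: below [L] so that a spike cannot be located, below [T1] so that even a
   single spike respects the [snr] budget. *)
pose mu := Num.min T1 L.
have mu_gt0 : 0 < mu by rewrite lt_min T1_gt0.
have mu_T1 : mu <= T1 by rewrite ge_min lexx.
have mu_L : mu <= L by rewrite ge_min lexx orbT.
have kmu_gt0 : 0 < kap * mu by rewrite mulr_gt0.
have kmu_le : kap * mu <= 1 / 2.
  apply: le_trans kap2; rewrite -[leRHS]mulr1; apply: ler_wpM2l; first exact: ltW.
  exact: le_trans T1_le1.
have [N [N_gt1 N_le N_ge]] := nat_inv_exists kmu_gt0 kmu_le.
(* [S] spikes are allowed by the radius, [T1 / L] by the [snr] budget. *)
pose y := y1 * Num.min S (T1 / L).
have y_gt0 : 0 < y by rewrite mulr_gt0 // lt_min S_gt0 divr_gt0.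
have [s [s_gt0 s_le s_ge]] := nat_floor_exists (ltW y_gt0).
have Ni0 : 0 < N%:R^-1 :> R by rewrite invr_gt0 ltr0n ltnW.
have s_le' : s = 1%N \/ s%:R <= S /\ s%:R <= T1 / L.
  case: s_le => [->|sy]; [by left|right].
  have yle : y <= Num.min S (T1 / L).
    rewrite -[leRHS]mul1r; apply: ler_wpM2r => //.
    by rewrite le_min (ltW S_gt0) divr_ge0 // ltW.
  by split; apply: le_trans sy (le_trans yle _); rewrite ge_min lexx ?orbT.
have sN : s%:R / N%:R <= kap * T1.
  case: s_le' => [->|[_ sT]].
    rewrite mul1r; apply: le_trans N_le _; apply: ler_wpM2l => //; exact: ltW.
  have -> : kap * T1 = T1 / L * (kap * L) by field; rewrite gt_eqF.
  apply: ler_pM => //.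
  by apply: le_trans N_le _; apply: ler_wpM2l => //; exact: ltW.
exists N, s; split=> //.
  case: s_le => [->|sy]; [by left|right].
  apply: le_trans sy _; apply: ler_wpM2l; first exact: ltW.
  by rewrite ge_min lexx.
split.
- by apply: le_trans N_le _; apply: ler_wpM2l => //; exact: ltW.
- have H1 : y1 / 2 * Num.min T1 (S * L) <= s%:R * mu.
    have s1 : 1 <= s%:R :> R by rewrite ler1n.
    have y12 : y1 / 2 <= 1 by apply: le_trans (_ : 1 / 2 <= _); [rewrite ler_wpM2r|lra].
    have m0 : 0 <= Num.min T1 (S * L) by rewrite le_min (ltW T1_gt0) mulr_ge0 // ltW.
    (* If [T1 <= L], one spike already reaches [T1]; otherwise [s >= y / 2] and [y * L] is [y1]
       times the smaller of [S * L] and [T1]. *)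
    rewrite /mu; have [TL|LT] := leP T1 L.
      apply: ler_pM => //; first by rewrite divr_ge0 // ltW.
        exact: le_trans s1.
      by rewrite ge_min lexx.
    apply: le_trans (_ : y / 2 * L <= _); last by apply: ler_wpM2r => //; exact: ltW.
    rewrite /y (_ : y1 * Num.min S (T1 / L) / 2 * L = y1 / 2 * (Num.min S (T1 / L) * L)); last by ring.
    apply: ler_wpM2l; first by rewrite divr_ge0 // ltW.
    rewrite le_eqVlt; apply/orP; left; apply/eqP.
    by rewrite minC minr_pMl ?(ltW L_gt0) // divfK // gt_eqF.
  have H2 : s%:R * (kap * mu / 2) <= s%:R / N%:R by apply: ler_wpM2l.
  apply: le_trans H2.
  have -> : s%:R * (kap * mu / 2) = kap / 2 * (s%:R * mu) by ring.
  have -> : kap * y1 / 4 * Num.min T1 (S * L) = kap / 2 * (y1 / 2 * Num.min T1 (S * L)) by field.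
  by apply: ler_wpM2l; rewrite ?divr_ge0 // ltW.
move=> J Js.
have N2 : 2 <= N%:R :> R by rewrite (ler_nat R 2).
have N0 : 0 < N%:R :> R by rewrite ltr0n ltnW.
have N1i : (N%:R - 1)^-1 <= 2 / N%:R :> R.
  rewrite -[2 / N%:R]invrK invf_div lef_pV2 ?posrE; lra.
have sJ : #|J|%:R <= s%:R :> R by rewrite ler_nat.
have snrE := snr_spikes R N J.
have snr_le : snr N k0 J <= 2 * kap * T1.
  rewrite snrE; apply: (@le_trans _ _ (s%:R * (2 / N%:R))).
    by apply: ler_pM => //; rewrite invr_ge0; lra.
  by rewrite mulrCA -mulrA ler_pM2l.
have N_eta : N%:R^-1 <= eta.
  apply: le_trans N_le _; apply: le_trans kap_eta; rewrite -[leRHS]mulr1.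
  by apply: ler_wpM2l; [exact: ltW|exact: le_trans T1_le1].
apply: (model_feasible q_gt0 cL_gt0 cL_lt_cU c1E etaE kap_gt0 kap2 kap_q N_gt1 _ N_eta
  T_gt0 T_tau rad_gt0 T_rad) => //.
- apply: le_trans snr_le _; apply: le_trans kap_eta2; rewrite -[leRHS]mulr1.
  by apply: ler_wpM2l => //; rewrite mulr_ge0 // ltW.
- apply: le_trans snr_le _; rewrite -/T1 mulrC; apply: ler_wpM2l; first exact: ltW.
  have := kap_le; lra.
(* Bounds the square of a spike entry of alpha, by [term_le] with [1 / (N - 1) <= 2 * kap * mu]. *)
pose z := 4 * kap / c1 * (M * mu).
have z0 : 0 <= z by rewrite !mulr_ge0 ?invr_ge0 // ltW.
apply: (@le_trans _ _ (s%:R * z `^ (q / 2))).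
  rewrite (bigID (fun j => j \in J)) /= [X in _ + X]big1 ?addr0 => [|j /negbTE jJ]; last first.
    by rewrite /loading jJ addr0 mul0r mulr0 powR0 // gt_eqF.
  apply: (@le_trans _ _ (#|J|%:R * z `^ (q / 2))); last by apply: ler_wpM2r => //; exact: powR_ge0.
  rewrite mulr_natl -sumr_const; apply: ler_sum => j jJ.
  have N'0 : 0 <= loading k0 J j / (noise_scale N c1 * (N%:R - (j \in J)%:R)).
    rewrite /loading jJ add0r div1r invr_ge0 mulr_ge0 ?sqrtr_ge0 // mulr1n; lra.
  rewrite sqr_powR_half; last exact: mulr_ge0 (amplitude_ge0 _ _) N'0.
  apply: ge0_ler_powR; rewrite ?nnegrE ?sqr_ge0 // ?divr_ge0 // ?(ltW q_gt0) //.
  apply: le_trans (term_le kap cL_gt0 cL_lt_cU c1E T k0 N_gt1 J j) _.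
  rewrite /loading jJ add0r expr1n mul1r.
  have /andP[_ AM] := amplitude_sqr kap_gt0 kap2 T_gt0.
  have -> : z = 2 / c1 * M * (2 * (kap * mu)) by rewrite /z; ring.
  apply: ler_pM.
  - by rewrite mulr_ge0 ?sqr_ge0 // divr_ge0 // ltW.
  - by rewrite invr_ge0 mulr1n; lra.
  - by apply: ler_wpM2l => //; rewrite divr_ge0 // ltW.
  - by apply: le_trans N1i _; rewrite ler_pM2l.
have C_gt0 : 0 < 16 * kap * Num.max 1 cU / c1.
  by rewrite divr_gt0 // mulr_gt0 ?mulr_gt0 // lt_max ltr01.
(* A single spike fits because [M * mu <= M * T1 = T]; several spikes fit by [S_rad], the condition
   that defines the admissible [S]. *)
case: s_le' => [->|[sS _]].
  rewrite mul1r; apply: (powR_scale (T := T / Num.max 1 cU) q_gt0 cL_gt0 cL_lt_cU c1E kap_gt0 kap_q z0) => //.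
  - by rewrite divr_gt0 // lt_max ltr01.
  - have -> : 16 * kap * Num.max 1 cU / c1 * (T / Num.max 1 cU) = 16 * kap / c1 * T.
      by field; rewrite !gt_eqF // lt_max ltr01.
    rewrite -MT1 /z; apply: ler_pM.
    + by rewrite divr_ge0 ?mulr_ge0 // ltW.
    + by rewrite mulr_ge0 // ltW.
    + by rewrite !ler_pM2r ?invr_gt0 // ler_nat.
    + by rewrite ler_pM2l.
  - exact: T_powR.
apply: (@le_trans _ _ (S * (((M * L) `^ (q / 2)) / 2))); last first.
  by rewrite mulrA ler_pM2r.
apply: ler_pM => //; first exact: powR_ge0.
apply: (powR_scale (T := M * L) q_gt0 cL_gt0 cL_lt_cU c1E kap_gt0 kap_q z0) => //.
- by rewrite mulr_gt0.
- by rewrite powR_gt0 // mulr_gt0.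
rewrite /z; apply: ler_pM.
- by rewrite divr_ge0 ?mulr_ge0 // ltW.
- by rewrite mulr_ge0 // ltW.
- rewrite ler_pM2r ?invr_gt0 //; apply: (@le_trans _ _ (16 * kap)).
    by rewrite ler_pM2r // ler_nat.
  rewrite -[leLHS]mulr1; apply: ler_wpM2l; first by rewrite mulr_ge0 // ltW.
  by rewrite le_max lexx.
- by rewrite ler_pM2l.
Qed.

End Sparse.

(** * Lower bounds at a fixed sample size *)

Section Rates.
Context (R : realType) (q cL cU c1 eta kap nu : R).
Hypotheses (q_gt0 : 0 < q) (cL_gt0 : 0 < cL) (cL_lt_cU : cL < cU)
  (nu_ge : Num.sqrt 2 <= nu)
  (c1E : c1 = (cL + cU) / 2) (etaE : eta = (c1 - cL) / (2 * c1))
  (kap_gt0 : 0 < kap) (kap_eta : kap <= eta)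
  (kap_eta2 : 8 * kap <= eta ^+ 2)
  (kap_q : (16 * kap * Num.max 1 cU / c1) `^ (q / 2) <= 1 / 2).
Variables (P n : nat) (T rad tau : R).
Hypotheses (P_gt0 : (0 < P)%N) (n_gt0 : (0 < n)%N)
  (T_gt0 : 0 < T) (T_tau : T <= tau) (rad_gt0 : 0 < rad)
  (T_rad : T <= cU * rad `^ (2 / q)).
Local Notation pR := (P.+1%:R : R).
Local Notation L := (ln pR / n%:R).
Local Notation A := (amplitude kap T).
Local Notation M := (Num.max 1 T).

Let pR_gt1 : 1 < pR. Proof. by rewrite ltr1n. Qed.
Let pR_gt0 : 0 < pR. Proof. exact: lt_trans pR_gt1. Qed.
Let lnp_gt0 : 0 < ln pR. Proof. by rewrite ln_gt0. Qed.
Let nR_gt0 : 0 < n%:R :> R. Proof. by rewrite ltr0n. Qed.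
Let L_gt0 : 0 < L. Proof. by rewrite divr_gt0. Qed.
Let c1_gt0 : 0 < c1.
Proof. by rewrite c1E divr_gt0 // addr_gt0 //; exact: lt_trans cL_lt_cU. Qed.
Let eta_gt0 : 0 < eta.
Proof.
by rewrite etaE divr_gt0 ?mulr_gt0 // subr_gt0 c1E; have := cL_lt_cU; lra.
Qed.
Let eta_lt : eta < 1 / 2.
Proof.
rewrite etaE ltr_pdivrMr ?mulr_gt0 //; have := cL_gt0; have := c1_gt0; lra.
Qed.
Let kap_small : kap <= 1 / 16.
Proof.
by have := kap_eta2; have := eta_gt0; have := eta_lt; rewrite expr2; nra.
Qed.

Let pR_powR d : pR `^ d = expR (d * ln pR).
Proof. by rewrite /powR gt_eqF. Qed.

(** The successor absorbs the rounding of the quotient; it is also the number of hypotheses per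
    block once the empty block is counted. *)
Lemma block_size (d : R) (s : nat) : 0 < d -> d <= 1 -> (0 < s)%N ->
  s = 1%N \/ s%:R <= pR `^ (1 - d) / 2 ->
  (s <= P)%N /\ pR `^ d / 2 <= (P %/ s).+1%:R.
Proof.
move=> d0 d1 s0 s_le.
have lnp := ltW lnp_gt0.
have p1 : 1 <= pR `^ (1 - d).
  rewrite pR_powR; apply: le_trans (expR_ge1Dx _).
  by rewrite lerDl mulr_ge0 // subr_ge0.
have pp : pR `^ (1 - d) * pR `^ d = pR.
  by rewrite -powRD ?subrK ?powRr1 // ?(ltW pR_gt0) // gt_eqF // implybT.
have pd : 1 <= pR `^ d.
  rewrite pR_powR; apply: le_trans (expR_ge1Dx _).
  by rewrite lerDl mulr_ge0 // ltW.
have P2 : pR / 2 <= P%:R.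
  have : 1 <= P%:R :> R by rewrite ler1n.
  rewrite -natr1; lra.
have s_le' : s%:R <= pR `^ (1 - d).
  by case: s_le => [->|]; [|lra].
split.
  case: s_le => [->//|s_le]; rewrite -(ler_nat R); apply: le_trans s_le _; apply: le_trans P2.
  have : pR `^ (1 - d) <= pR `^ (1 - d) * pR `^ d by rewrite ler_peMr // powR_ge0.
  by rewrite pp; lra.
have H : (P < (P %/ s).+1 * s)%N by rewrite ltn_ceil.
have H' : P%:R <= (P %/ s).+1%:R * s%:R :> R by rewrite -natrM ler_nat ltnW.
have H2 : pR / 2 <= (P %/ s).+1%:R * pR `^ (1 - d).
  apply: le_trans P2 (le_trans H' _); exact: ler_wpM2l.
have q0 : 0 < pR `^ (1 - d) by apply: lt_le_trans p1.
by rewrite -(ler_pM2r q0) mulrAC [_ `^ d * _]mulrC pp.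
Qed.

(** The logarithm in [L] is what a search among polynomially many positions costs: second moments
    may grow up to [pR ^ kap], a power well below the block size. *)
Lemma growth_le (N : nat) : N%:R^-1 <= kap * L ->
  (1 + N%:R^-1 : R) ^+ n <= expR (kap * ln pR).
Proof.
move=> NL; apply: le_trans (onepV_exp_le _ _ _) _; rewrite ler_expR.
apply: (@le_trans _ _ (n%:R * (kap * L))); first by apply: ler_wpM2l.
by rewrite le_eqVlt; apply/orP; left; apply/eqP; field; rewrite gt_eqF.
Qed.

Variables (S y1 delta : R).
Hypotheses (S_gt0 : 0 < S) (S_rad : S * (M * L) `^ (q / 2) <= rad)
  (y1_gt0 : 0 < y1) (y1_le1 : y1 <= 1) (delta_gt0 : 0 < delta) (delta_le1 : delta <= 1)
  (kap_delta : kap <= delta / 100).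

Lemma alpha_rate : y1 * S <= pR `^ (1 - delta) / 2 ->
  ((kap ^+ 2 * y1 / (64 * c1) * (M * Num.min (Num.min T 1) (S * L)))%:E <=
    minimax_alpha n P.+1 q cL cU nu rad tau)%E.
Proof.
move=> yS.
have kap4 : kap <= 1 / 4 by apply: le_trans kap_small _; lra.
have kap2 : kap <= 1 / 2 by apply: le_trans kap_small _; lra.
have kapeta2 : 2 * kap <= eta ^+ 2.
  by apply: le_trans kap_eta2; apply: ler_wpM2r; [exact: ltW|lra].
have [N [s [N_gt1 s_gt0 s_le [NL sN HJ]]]] := sparse_setting q_gt0 cL_gt0 cL_lt_cU c1E
  etaE kap_gt0 kap4 kap_eta kapeta2 kap_q P T_gt0 T_tau rad_gt0 T_rad L_gt0 S_gt0 S_rad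
  y1_gt0 y1_le1.
have [sP mp] : (s <= P)%N /\ pR `^ delta / 2 <= (P %/ s).+1%:R.
  apply: block_size => //; case: s_le => [->|h]; [by left|right].
  exact: le_trans h yS.
pose m := (P %/ s)%N.
have m_gt0 : (0 < m)%N by rewrite divn_gt0.
have [pos pos_inj] : exists pos : 'I_s * 'I_m -> 'I_P, injective pos.
  by apply: block_pos_exists; rewrite mulnC leq_trunc_div.
have G_le : (1 + N%:R^-1 : R) ^+ n <= 9 / 16 * m.+1%:R.
  apply: le_trans (growth_le NL) _.
  have m2 : 2 <= m.+1%:R :> R by rewrite (ler_nat R 2) ltnS.
  pose x := delta * ln pR.
  have x0 : 0 <= x by rewrite mulr_ge0 // ltW.
  have kx : kap * ln pR <= x / 100.
    by rewrite /x mulrAC ler_pM2r.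
  rewrite pR_powR -/x in mp.
  apply: (@le_trans _ _ (expR (x / 100))); first by rewrite ler_expR.
  (* For small [x] two hypotheses per block suffice, since [expR (1 / 10) <= 9 / 8]; for large [x],
     [m.+1 >= expR x / 2] is far above [expR (x / 100)]. *)
  have [x10|x10] := leP x 10.
    apply: (@le_trans _ _ (9 / 8)); last lra.
    apply: (@le_trans _ _ (expR (1 / 10))); first by rewrite ler_expR; lra.
    rewrite -[1 / 10]opprK expRN invf_ple ?posrE ?expR_gt0 //.
    by apply: le_trans (expR_ge1Dx _); lra.
  have -> : x / 100 = x + - (99 / 100 * x) by lra.
  have e0 : 0 < expR x by exact: expR_gt0.
  have e1 : expR (- (99 / 100 * x)) <= 1 / 4.
    rewrite expRN invf_ple ?posrE ?expR_gt0 //.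
    by apply: le_trans (expR_ge1Dx _); lra.
  rewrite expRD; apply: (@le_trans _ _ (expR x * (1 / 4))); first by rewrite ler_pM2l.
  by rewrite -/m in mp; lra.
have A1 : ~~ (1 < T) -> A = 1 by rewrite /amplitude => /negbTE ->.
apply: le_trans (minimax_alpha_ge N_gt1 A1 c1_gt0 nu_ge pos_inj _ G_le); last first.
  by move=> f; apply: HJ; exact: card_pblock_set.
rewrite lee_fin.
have /andP[AM _] := amplitude_sqr kap_gt0 kap2 T_gt0.
have N2 : 2 <= N%:R :> R by rewrite (ler_nat R 2).
have spike_ge : A ^+ 2 / (c1 * N%:R) <= spike N A c1 ^+ 2.
  rewrite /spike expr_div_n exprMn sqr_sqrtr; last by rewrite divr_ge0 // ltW.
  apply: ler_wpM2l; first exact: sqr_ge0.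
  rewrite lef_pV2 ?posrE; last 2 first.
  - by rewrite mulr_gt0 //; lra.
  - by rewrite mulr_gt0 ?exprn_gt0 ?divr_gt0 //; lra.
  rewrite -mulrA; apply: ler_wpM2l; first exact: ltW.
  by rewrite mulrC ler_pdivrMr; [rewrite -expr2 lerXn2r ?nnegrE; lra|lra].
apply: (@le_trans _ _ (s%:R * (A ^+ 2 / (c1 * N%:R)) / 16)); last first.
  by rewrite ler_pM2r // ler_wpM2l.
have -> : s%:R * (A ^+ 2 / (c1 * N%:R)) / 16 = (A ^+ 2 * (s%:R / N%:R)) / (16 * c1).
  by field; rewrite !gt_eqF //; lra.
set W := Num.min _ _.
have -> : kap ^+ 2 * y1 / (64 * c1) * (M * W) = (kap * M) * (kap * y1 / 4 * W) / (16 * c1).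
  by field; rewrite gt_eqF.
have W0 : 0 <= W by rewrite !le_min (ltW T_gt0) ler01 mulr_ge0 // ltW.
rewrite ler_pM2r ?invr_gt0 ?mulr_gt0 //; apply: ler_pM => //.
- by rewrite mulr_ge0 ?le_max ?ler01 // ltW.
- by rewrite mulr_ge0 ?divr_ge0 ?mulr_ge0 // ltW.
Qed.

Lemma theta_sparse_rate : (y1 * S) ^+ 2 <= pR `^ (1 - delta) / 4 ->
  ((kap ^+ 2 * y1 / 32 * (M * Num.min (Num.min T 1) (S * L)))%:E <=
    minimax_theta n P.+1 q cL cU nu rad tau)%E.
Proof.
move=> yS.
have kap4 : kap <= 1 / 4 by apply: le_trans kap_small _; lra.
have kap2 : kap <= 1 / 2 by apply: le_trans kap_small _; lra.
have kapeta2 : 2 * kap <= eta ^+ 2.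
  by apply: le_trans kap_eta2; apply: ler_wpM2r; [exact: ltW|lra].
have [N [s [N_gt1 s_gt0 s_le [NL sN HJ]]]] := sparse_setting q_gt0 cL_gt0 cL_lt_cU c1E
  etaE kap_gt0 kap4 kap_eta kapeta2 kap_q P T_gt0 T_tau rad_gt0 T_rad L_gt0 S_gt0 S_rad
  y1_gt0 y1_le1.
have lnp := ltW lnp_gt0.
have p1 : 1 <= pR `^ (1 - delta).
  rewrite pR_powR; apply: le_trans (expR_ge1Dx _).
  by rewrite lerDl mulr_ge0 // subr_ge0.
have s1 : 1 <= s%:R :> R by rewrite ler1n.
have s2 : s%:R ^+ 2 <= pR `^ (1 - delta).
  case: s_le => [->|h]; first by rewrite expr1n.
  apply: (@le_trans _ _ ((y1 * S) ^+ 2)); last lra.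
  by apply: lerXn2r; rewrite ?nnegrE // mulr_ge0 // ltW.
have [sP _] : (s <= P)%N /\ pR `^ delta / 2 <= (P %/ s).+1%:R.
  apply: block_size => //; case: s_le => [->|h]; [by left|right].
  have h2 : s%:R ^+ 2 <= (y1 * S) ^+ 2.
    by apply: lerXn2r; rewrite ?nnegrE // mulr_ge0 // ltW.
  have : s%:R <= s%:R ^+ 2 :> R by rewrite expr2 ler_peMr.
  have := powR_ge0 pR (1 - delta); lra.
pose m := (P %/ s)%N.
have m_gt0 : (0 < m)%N by rewrite divn_gt0.
have mR_gt0 : 0 < m%:R :> R by rewrite ltr0n.
have [pos pos_inj] : exists pos : 'I_s * 'I_m -> 'I_P, injective pos.
  by apply: block_pos_exists; rewrite mulnC leq_trunc_div.
pose x := delta * ln pR.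
have x0 : 0 <= x by rewrite mulr_ge0 // ltW.
(* [s / m] is [s ^ 2 / (s * m)], with [s ^ 2] at most [pR * expR (- x)] and [s * m] at least
   [pR / 4]. *)
have sm : s%:R / m%:R <= 4 * expR (- x).
  have pp : pR `^ (1 - delta) = pR * expR (- x).
    rewrite pR_powR mulrBl mul1r expRD lnK // posrE //.
  have H : (P < m.+1 * s)%N by rewrite ltn_ceil.
  have m4 : (m.+1 <= 4 * m)%N.
    rewrite -addn1; apply: (@leq_trans (m + m)); first by rewrite leq_add2l.
    by rewrite addnn -mul2n leq_mul2r orbT.
  have H' : (P.+1 <= 4 * (m * s))%N by apply: leq_trans H _; rewrite mulnA leq_mul2r m4 orbT.
  have H2 : pR <= 4 * (m%:R * s%:R) by rewrite -2!natrM ler_nat.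
  rewrite ler_pdivrMr // -(ler_pM2r (_ : 0 < s%:R)); last by rewrite ltr0n.
  rewrite -expr2; apply: le_trans s2 _; rewrite pp.
  have e0 := expR_gt0 (- x).
  have -> : 4 * expR (- x) * m%:R * s%:R = (4 * (m%:R * s%:R)) * expR (- x) by ring.
  by rewrite ler_pM2r.
have G_le : s%:R * ((1 + N%:R^-1 : R) ^+ n - 1) / m%:R <= 1 / 4.
  have kx : kap * ln pR <= x / 100 by rewrite /x mulrAC ler_pM2r.
  pose t := x / 100.
  have t0 : 0 <= t by rewrite divr_ge0.
  (* The factor [t] matters for [x] near 0, where [s / m] is only known to be at most about 4. *)
  have g1 : (1 + N%:R^-1 : R) ^+ n - 1 <= t * expR t.
    have : (1 + N%:R^-1 : R) ^+ n <= expR t.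
      by apply: le_trans (growth_le NL) _; rewrite ler_expR.
    have : expR t * (1 - t) <= 1.
      rewrite -[leRHS](expRxMexpNx_1 t) ler_pM2l ?expR_gt0 //; exact: expR_ge1Dx.
    lra.
  rewrite mulrAC; apply: (@le_trans _ _ (4 * expR (- x) * (t * expR t))).
    apply: ler_pM => //.
    by rewrite subr_ge0 exprn_ege1 // lerDl invr_ge0.
  have -> : 4 * expR (- x) * (t * expR t) = 4 * t * expR (- (99 * t)).
    have -> : - (99 * t) = - x + t by rewrite /t; field.
    by rewrite expRD; ring.
  rewrite expRN ler_pdivrMr ?expR_gt0 //.
  by have := expR_ge1Dx (99 * t); lra.
have A1 : ~~ (1 < T) -> A = 1 by rewrite /amplitude => /negbTE ->.
have /andP[AM _] := amplitude_sqr kap_gt0 kap2 T_gt0.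
have N2 : 2 <= N%:R :> R by rewrite (ler_nat R 2).
have D_ge0 : 0 <= A ^+ 2 * (s%:R / N%:R) by rewrite mulr_ge0 ?sqr_ge0 ?divr_ge0.
apply: le_trans (minimax_theta_ge N_gt1 A1 c1_gt0 nu_ge pos_inj m_gt0 D_ge0 _ _ _ G_le).
- rewrite lee_fin; set W := Num.min _ _.
  have -> : kap ^+ 2 * y1 / 32 * (M * W) = (kap * M) * (kap * y1 / 4 * W) / 8 by field.
  have W0 : 0 <= W by rewrite !le_min (ltW T_gt0) ler01 mulr_ge0 // ltW.
  rewrite ler_pM2r //; apply: ler_pM => //.
  + by rewrite mulr_ge0 ?le_max ?ler01 // ltW.
  + by rewrite mulr_ge0 ?divr_ge0 ?mulr_ge0 // ltW.
- by apply: HJ; rewrite cards0.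
- by move=> f; apply: HJ; rewrite card_block_set.
- move=> f; apply: ler_wpM2l; first exact: sqr_ge0.
  rewrite !snr_spikes cards0 mul0r subr0 card_block_set //.
  by apply: ler_wpM2l => //; rewrite lef_pV2 ?posrE; lra.
Qed.

Lemma theta_param_rate :
  ((kap ^+ 2 / 16 * (M * Num.sqrt (Num.min T 1 * Num.min (Num.min T 1) n%:R^-1)))%:E <=
    minimax_theta n P.+1 q cL cU nu rad tau)%E.
Proof.
have kap2 : kap <= 1 / 2 by apply: le_trans kap_small _; lra.
pose T1 := Num.min T 1.
have T1_gt0 : 0 < T1 by rewrite lt_min T_gt0 ltr01.
have T1_le1 : T1 <= 1 by rewrite ge_min lexx orbT.
(* A known position leaves no search to hide in, so [n / N] must be bounded and no logarithm
   appears. *)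
pose mu := Num.min T1 n%:R^-1.
have mu_gt0 : 0 < mu by rewrite lt_min T1_gt0 invr_gt0.
have mu_T1 : mu <= T1 by rewrite ge_min lexx.
have mu_n : mu <= n%:R^-1 by rewrite ge_min lexx orbT.
have kmu_gt0 : 0 < kap * mu by rewrite mulr_gt0.
have kmu_T1 : kap * mu <= kap * T1 by rewrite ler_pM2l.
have kT1 : kap * T1 <= kap by rewrite -[leRHS]mulr1 ler_pM2l.
have [N [N_gt1 N_le N_ge]] := nat_inv_exists kmu_gt0 (le_trans kmu_T1 (le_trans kT1 kap2)).
have N2 : 2 <= N%:R :> R by rewrite (ler_nat R 2).
(* The largest order of [k] for which [snr], about [K ^ 2 / N], stays below a multiple of [T1]. The
   gap [((K + 1) ^ 2 - K ^ 2) / N] is then at least [K / N], of order [sqrt (T1 * mu)]. *)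
pose K := Num.sqrt (kap * T1 * N%:R).
have kT0 : 0 <= kap * T1 * N%:R by rewrite !mulr_ge0 // ltW.
have K2 : K ^+ 2 = kap * T1 * N%:R by rewrite sqr_sqrtr.
have K0 : 0 <= K by exact: sqrtr_ge0.
pose j0 := Ordinal P_gt0.
pose k (j : 'I_P) : R := if j == j0 then K else 0.
have k_ge0 j : 0 <= k j by rewrite /k; case: ifP.
have Ji (J : {set 'I_P}) : (forall j, j \in J -> j = j0) -> forall j, j != j0 ->
  loading k J j = 0.
  move=> HJ j jj0; rewrite /loading /k (negbTE jj0) add0r.
  by case: (boolP (j \in J)) => // /HJ E; move: jj0; rewrite E eqxx.
have snrJ (J : {set 'I_P}) : (forall j, j \in J -> j = j0) ->
  snr N k J = (K + (j0 \in J)%:R) ^+ 2 / (N%:R - (j0 \in J)%:R).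
  move=> HJ; rewrite /snr (bigD1 j0) //= [X in _ + X]big1 ?addr0 => [|j jj0].
    by rewrite /loading /k eqxx.
  by rewrite Ji // expr2 !mul0r.
have N1i : (N%:R - 1)^-1 <= 2 / N%:R :> R.
  by rewrite -[2 / N%:R]invrK invf_div lef_pV2 ?posrE; lra.
have snr_le (J : {set 'I_P}) : (forall j, j \in J -> j = j0) -> snr N k J <= 8 * kap * T1.
  move=> HJ; rewrite snrJ //.
  apply: (@le_trans _ _ ((2 * K ^+ 2 + 2) * (2 / N%:R))).
    have e1 : (j0 \in J)%:R <= 1 :> R by rewrite lern1 leq_b1.
    have e0 : 0 <= (j0 \in J)%:R :> R by [].
    apply: ler_pM; rewrite ?sqr_ge0 ?invr_ge0 //; first lra.
      move: ((j0 \in J)%:R : R) e0 e1 => e e0 e1.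
      have : e ^+ 2 <= 1 by rewrite expr_le1.
      by have := sqr_ge0 (K - e); lra.
    by apply: le_trans N1i; rewrite lef_pV2 ?posrE; lra.
  have -> : (2 * K ^+ 2 + 2) * (2 / N%:R) = 4 * (kap * T1) + 4 * N%:R^-1.
    by rewrite K2; field; rewrite gt_eqF //; lra.
  lra.
have HJ (J : {set 'I_P}) : (forall j, j \in J -> j = j0) -> Hq q cL cU rad tau
    (model_mean N (1 < T) A c1 k J) (model_cov N (1 < T) c1 k J).
  move=> J0; have sJ := snr_le J J0.
  have N_eta : N%:R^-1 <= eta.
    by apply: le_trans N_le (le_trans kmu_T1 (le_trans kT1 kap_eta)).
  apply: (model_feasible q_gt0 cL_gt0 cL_lt_cU c1E etaE kap_gt0 kap2 kap_q N_gt1 k_ge0 N_eta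
    T_gt0 T_tau rad_gt0 T_rad).
  - apply: le_trans sJ _; apply: le_trans kap_eta2; rewrite -mulrA; lra.
  - apply: le_trans sJ _; rewrite -/T1 mulrC; apply: ler_wpM2l; first exact: ltW.
    by have := kap_small; lra.
  rewrite (bigD1 j0) //= [X in _ + X]big1 ?addr0 => [|j jj0]; last first.
    by rewrite Ji // mul0r mulr0 powR0 // gt_eqF.
  have N'0 : 0 < N%:R - (j0 \in J)%:R :> R.
    by have : (j0 \in J)%:R <= 1 :> R by [rewrite lern1 leq_b1]; lra.
  have load0 : 0 <= loading k J j0 by rewrite addr_ge0.
  rewrite sqr_powR_half; last first.
    apply: mulr_ge0 (amplitude_ge0 _ _) _; apply: divr_ge0 load0 _.
    by rewrite mulr_ge0 ?sqrtr_ge0 // ltW.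
  have m0 : 0 < Num.max 1 cU by rewrite lt_max ltr01.
  apply: (powR_scale (T := T / Num.max 1 cU) q_gt0 cL_gt0 cL_lt_cU c1E kap_gt0 kap_q) => //.
  - exact: sqr_ge0.
  - by rewrite divr_gt0.
  - apply: le_trans (term_le kap cL_gt0 cL_lt_cU c1E T k N_gt1 J j0) _.
    have /andP[_ AM] := amplitude_sqr kap_gt0 kap2 T_gt0.
    have -> : 16 * kap * Num.max 1 cU / c1 * (T / Num.max 1 cU) = 16 * kap / c1 * T.
      by field; rewrite !gt_eqF.
    have MT1 : M * T1 = T.
      by rewrite /T1; case: (leP T 1) => _; rewrite ?mul1r ?mulr1.
    rewrite -[X in _ <= _ * X]MT1.
    have -> : 16 * kap / c1 * (M * T1) = (2 / c1 * M) * (8 * kap * T1) by ring.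
    apply: ler_pM.
    + by rewrite mulr_ge0 ?sqr_ge0 // divr_ge0 // ltW.
    + by apply: divr_ge0; [exact: sqr_ge0|exact: ltW].
    + by apply: ler_wpM2l => //; rewrite divr_ge0 // ltW.
    + by move: sJ; rewrite snrJ // /loading /k eqxx.
  - exact: T_powR.
have A1 : ~~ (1 < T) -> A = 1 by rewrite /amplitude => /negbTE ->.
have /andP[AM _] := amplitude_sqr kap_gt0 kap2 T_gt0.
(* One block with one position: the mixture reduces to a single alternative. *)
pose pos (_ : 'I_1 * 'I_1) := j0.
have pos_inj : injective pos by move=> [a b] [a' b'] _; congr pair; rewrite [LHS]ord1 [RHS]ord1.
have JE f : block_set pos f = [set j0]%SET.
  apply/finset.setP => j; rewrite inE; apply/imsetP/eqP => [[b _ ->]//|->].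
  by exists ord0.
have G_le : 1%:R * ((1 + N%:R^-1 : R) ^+ n - 1) / 1%:R <= 1 / 4.
  have : (1 + N%:R^-1 : R) ^+ n <= 5 / 4.
    apply: le_trans (onepV_exp_le _ _ _) _.
    apply: (@le_trans _ _ (expR (1 / 16))).
      rewrite ler_expR; apply: le_trans kap_small.
      apply: (@le_trans _ _ (n%:R * (kap * n%:R^-1))).
        apply: ler_wpM2l => //; apply: le_trans N_le _; exact: ler_wpM2l (ltW kap_gt0) _ _ mu_n.
      by rewrite mulrCA divff ?mulr1 // gt_eqF.
    rewrite -[1 / 16]opprK expRN invf_ple ?posrE ?expR_gt0 //.
    by apply: le_trans (expR_ge1Dx _); lra.
  lra.
have D_ge0 : 0 <= A ^+ 2 * (K / N%:R) by rewrite mulr_ge0 ?sqr_ge0 ?divr_ge0.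
apply: le_trans (minimax_theta_ge N_gt1 A1 c1_gt0 nu_ge pos_inj (ltn0Sn 0) D_ge0 _ _ _ G_le).
- rewrite lee_fin -/T1 -/mu; set W := Num.sqrt _.
  have -> : kap ^+ 2 / 16 * (M * W) = (kap * M) * (kap / 2 * W) / 8 by field.
  rewrite ler_pM2r //; apply: ler_pM => //.
  + by rewrite mulr_ge0 ?le_max ?ler01 // ltW.
  + by rewrite mulr_ge0 ?sqrtr_ge0 // divr_ge0 // ltW.
  + have N0 : 0 < N%:R :> R by rewrite ltr0n ltnW.
    rewrite -(@ler_pXn2r _ 2) ?nnegrE //; last 2 first.
    * by rewrite mulr_ge0 ?sqrtr_ge0 // divr_ge0 // ltW.
    * by rewrite divr_ge0.
    rewrite !exprMn !exprVn K2 sqr_sqrtr; last by rewrite mulr_ge0 // ltW.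
    have -> : kap * T1 * N%:R / N%:R ^+ 2 = kap * T1 * N%:R^-1 by field; rewrite gt_eqF.
    apply: (@le_trans _ _ (kap * T1 * (kap * mu / 2))); last first.
      by apply: ler_wpM2l => //; rewrite mulr_ge0 // ltW.
    have : 0 <= kap * T1 * (kap * mu) by rewrite mulr_ge0 // ltW // mulr_gt0.
    lra.
- by apply: HJ => j; rewrite inE.
- by move=> f; apply: HJ => j; rewrite JE inE => /eqP.
- move=> f; apply: ler_wpM2l; first exact: sqr_ge0.
  rewrite !snrJ; last 2 first.
  + by move=> j; rewrite inE.
  + by move=> j; rewrite JE inE => /eqP.
  rewrite JE !inE eqxx mulr1n mulr0n addr0 subr0.
  apply: (@le_trans _ _ ((K + 1) ^+ 2 / N%:R - K ^+ 2 / N%:R)).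
    rewrite -mulrBl; apply: ler_wpM2r; first by rewrite invr_ge0.
    lra.
  rewrite lerD2r; apply: ler_wpM2l; first exact: sqr_ge0.
  by rewrite lef_pV2 ?posrE; lra.
Qed.

End Rates.

(** * Uniform constants and comparison with the stated rates *)

Lemma kap_exists (R : realType) (q eta c1 cU delta : R) :
  0 < q -> 0 < eta -> 0 < c1 -> 0 < delta ->
  exists2 kap : R, 0 < kap &
    [/\ kap <= eta, 8 * kap <= eta ^+ 2, kap <= delta / 100
      & (16 * kap * Num.max 1 cU / c1) `^ (q / 2) <= 1 / 2].
Proof.
move=> q0 eta0 c10 delta0.
have m0 : 0 < Num.max 1 cU by rewrite lt_max ltr01.
(* Obtained by solving the last condition for equality. *)
pose k4 := (1 / 2) `^ (2 / q) * c1 / (16 * Num.max 1 cU).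
have k40 : 0 < k4 by rewrite divr_gt0 ?mulr_gt0 ?powR_gt0 //; lra.
have eta2 : 0 < eta ^+ 2 / 8 by rewrite divr_gt0 ?exprn_gt0.
exists (Num.min (Num.min eta (eta ^+ 2 / 8)) (Num.min (delta / 100) k4)).
  by rewrite !lt_min eta0 eta2 k40 divr_gt0.
set kap := Num.min _ _.
have [k1 k2 k3 k4'] : [/\ kap <= eta, kap <= eta ^+ 2 / 8, kap <= delta / 100 & kap <= k4].
  by split; rewrite /kap !ge_min lexx ?orbT.
have kap0 : 0 <= kap by rewrite !le_min (ltW eta0) (ltW eta2) (ltW k40) divr_ge0 // ltW.
split=> //; first lra.
have q20 : 0 <= q / 2 by rewrite divr_ge0 // ltW.
have E : 16 * kap * Num.max 1 cU / c1 <= (1 / 2) `^ (2 / q).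
  rewrite ler_pdivrMr //; move: k4'; rewrite /k4 ler_pdivlMr ?mulr_gt0 //.
  by rewrite mulrA [kap * 16]mulrC.
apply: (@le_trans _ _ (((1 / 2) `^ (2 / q)) `^ (q / 2))).
  by apply: ge0_ler_powR; rewrite ?nnegrE ?powR_ge0 // !mulr_ge0 ?invr_ge0 ?(ltW m0) ?(ltW c10).
rewrite -powRrM mulrA mulfVK ?gt_eqF // divff // powRr1 //; lra.
Qed.

Section RateBounds.
Context (R : realType).
Implicit Types T L r q x : R.

Lemma powR_subl x q : 0 < x -> x `^ (1 - q) = x * x `^ (- q).
Proof.
move=> x0; rewrite powRD; last by rewrite (gt_eqF x0) implybT.
by rewrite powRr1 // ltW.
Qed.

Lemma powRN_sqr x q : (x `^ (- (q / 2))) ^+ 2 = x `^ (- q).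
Proof.
rewrite -powR_mulrn ?powR_ge0 // -powRrM; congr (_ `^ _).
by field.
Qed.

Lemma spike_scale_le T L r q : 0 < T -> 0 < L -> 0 < r -> 0 < q ->
  r * (1 + T) `^ (- (q / 2)) * L `^ (- (q / 2)) * (Num.max 1 T * L) `^ (q / 2) <= r.
Proof.
move=> T0 L0 r0 q0.
have M0 : 0 < Num.max 1 T by rewrite lt_max ltr01.
have T1 : 0 < 1 + T by rewrite addr_gt0.
rewrite powRM ?(ltW M0) ?(ltW L0) // !powRN.
have tp := powR_gt0 (q / 2) T1; have lp := powR_gt0 (q / 2) L0.
have -> : r * ((1 + T) `^ (q / 2))^-1 * (L `^ (q / 2))^-1 *
   (Num.max 1 T `^ (q / 2) * L `^ (q / 2)) =
   r * (Num.max 1 T `^ (q / 2) / (1 + T) `^ (q / 2)) by field; rewrite !gt_eqF.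
rewrite -[leRHS]mulr1 ler_pM2l // ler_pdivrMr // mul1r.
apply: ge0_ler_powR; rewrite ?nnegrE ?(ltW M0) ?(ltW T1) ?divr_ge0 ?(ltW q0) //.
by rewrite ge_max lerDl lerDr (ltW T0) ler01.
Qed.

(** Rewrites the rate in the shape that the construction delivers, from [1 + T <= 2 * max 1 T] and
    [T = max 1 T * min T 1]. *)
Lemma rate_le T L r q : 0 < T -> 0 < L -> 0 < r ->
  Num.min T ((1 + T) `^ (1 - q / 2) * r * L `^ (1 - q / 2)) <=
  2 * (Num.max 1 T * Num.min (Num.min T 1)
    (r * (1 + T) `^ (- (q / 2)) * L `^ (- (q / 2)) * L)).
Proof.
move=> T0 L0 r0.
have T1 : 0 < 1 + T by rewrite addr_gt0.
rewrite !powR_subl //.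
set S := r * _ * _.
have S0 : 0 < S by rewrite !mulr_gt0 ?powR_gt0.
have -> : (1 + T) * (1 + T) `^ (- (q / 2)) * r * (L * L `^ (- (q / 2))) = (1 + T) * (S * L).
  by rewrite /S; ring.
have SL : 0 < S * L by rewrite mulr_gt0.
move: (S * L) SL => z z0 {S S0}.
by case: (leP T 1) => TT; case: (leP T z) => Tz; case: (leP 1 z) => z1;
  rewrite ?(min_l TT) //; rewrite ge_min; apply/orP; (try (left; nra)); right; nra.
Qed.

(** The two-point bound is of order [T], [sqrt (T / n)] or [T / sqrt n] according to the position of
    [T] relative to [1 / n] and 1, and [T + sqrt T] is at most twice its larger term. *)
Lemma param_rate_le T (n : nat) : 0 < T -> (0 < n)%N ->
  Num.min T ((T + Num.sqrt T) / Num.sqrt n%:R) <=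
  2 * (Num.max 1 T * Num.sqrt (Num.min T 1 * Num.min (Num.min T 1) n%:R^-1)).
Proof.
move=> T0 n0.
have nR : 1 <= n%:R :> R by rewrite ler1n.
have nR0 : 0 < n%:R :> R by lra.
have ni1 : n%:R^-1 <= 1 :> R by rewrite invf_le1.
have sn : 0 < Num.sqrt n%:R :> R by rewrite sqrtr_gt0.
have sT : 0 <= Num.sqrt T by exact: sqrtr_ge0.
have sT2 : Num.sqrt T ^+ 2 = T by rewrite sqr_sqrtr // ltW.
have [T1|T1] := leP T 1.
- rewrite mul1r; have [Tn|Tn] := leP T n%:R^-1.
    rewrite -expr2 sqrtr_sqr gtr0_norm // ge_min; apply/orP; left; lra.
  rewrite ge_min; apply/orP; right.
  rewrite sqrtrM ?(ltW T0) // sqrtrV ?(ltW nR0) // mulrA ler_pM2r ?invr_gt0 //.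
  have : Num.sqrt T <= 1 by rewrite -sqrtr1 ler_wsqrtr.
  nra.
- rewrite mul1r (min_r ni1) ge_min; apply/orP; right.
  rewrite sqrtrV ?(ltW nR0) // mulrA ler_pM2r ?invr_gt0 //.
  have : 1 <= Num.sqrt T by rewrite -[leLHS]sqrtr1 ler_wsqrtr // ltW.
  nra.
Qed.
End RateBounds.

Section PerSampleSize.
Context (R : realType) (q cL cU rad tau : R) (p n : nat).
Hypotheses (cL_gt0 : 0 < cL) (cU_gt0 : 0 < cU)
  (p_gt0 : (0 < p)%N) (rad_gt0 : 0 < rad) (tau_gt0 : 0 < tau).

Lemma ttau_gt0 : 0 < ttau q cU rad tau.
Proof. by rewrite lt_min tau_gt0 mulr_gt0 // powR_gt0. Qed.

Lemma ttau_le : ttau q cU rad tau <= tau /\ ttau q cU rad tau <= cU * rad `^ (2 / q).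
Proof. by rewrite /ttau !ge_min !lexx orbT. Qed.

Lemma tR_gt0 : 0 < tR p q cL rad tau.
Proof. by rewrite lt_min rad_gt0 andbT !mulr_gt0 ?powR_gt0 ?ltr0n. Qed.

Lemma tR_le : tR p q cL rad tau <= rad.
Proof. by rewrite /tR ge_min lexx orbT. Qed.

(* For [p = 1] the power [0 `^ x] is [0], so the lower bound on the sparsity fails. *)
Lemma dim_gt1 (a x C : R) : x != 0 ->
  (1%:E <= C%:E * (a * (ln p%:R / n%:R) `^ x)%:E)%E -> (1 < p)%N.
Proof.
move=> x0; rewrite -EFinM lee_fin => H; rewrite ltn_neqAle p_gt0 andbT.
apply/eqP => p1; move: H.
by rewrite -p1 ln1 mul0r powR0 // !mulr0 ler10.
Qed.
End PerSampleSize.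

Lemma EFin_scale_le (R : realType) (x b K : R) (g : \bar R) : 0 <= K ->
  x <= K * b -> (b%:E <= g)%E -> (x%:E <= K%:E * g)%E.
Proof.
move=> K0 xb bg; apply: (@le_trans _ _ (K%:E * b%:E)%E).
  by rewrite -EFinM lee_fin.
by apply: lee_wpmul2l.
Qed.

Theorem theorem5 (R : realType) (q cL cU nu : R)
    (p : nat -> nat) (rad tau : nat -> R)
    (q_gt0 : 0 < q) (q_le1 : q <= 1)
    (cL_gt0 : 0 < cL) (cL_lt_cU : cL < cU)
    (nu_ge : Num.sqrt 2 <= nu)
    (p_gt0 : forall n, (0 < n)%N -> (0 < p n)%N)
    (rad_gt0 : forall n, (0 < n)%N -> 0 < rad n)
    (tau_gt0 : forall n, (0 < n)%N -> 0 < tau n) :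
  let T := fun n => ttau q cU (rad n) (tau n) in
  let r := fun n => tR (p n) q cL (rad n) (tau n) in
  let L := fun n => ln (p n)%:R / n%:R in
  let rate := fun n => Num.min (T n)
    ((1 + T n) `^ (1 - q / 2) * r n * L n `^ (1 - q / 2)) in
  (fun n => r n * (1 + T n) `^ (- (q / 2)) * L n `^ (1 - q / 2)) @ \oo
    --> (0 : R) ->
  ((exists2 delta : R, 0 < delta &
      lesssim (fun=> 1%:E)
        (fun n => (r n * (1 + T n) `^ (- (q / 2)) * L n `^ (- (q / 2)))%:E) /\
      lesssim
        (fun n => (r n * (1 + T n) `^ (- (q / 2)) * L n `^ (- (q / 2)))%:E)
        (fun n => ((p n)%:R `^ (1 - delta))%:E)) ->
   lesssim (fun n => (rate n)%:E)
     (fun n => minimax_alpha n (p n) q cL cU nu (rad n) (tau n)))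
  /\
  ((exists2 delta : R, 0 < delta &
      lesssim (fun=> 1%:E)
        (fun n => (r n ^+ 2 * (1 + T n) `^ (- q) * L n `^ (- q))%:E) /\
      lesssim
        (fun n => (r n ^+ 2 * (1 + T n) `^ (- q) * L n `^ (- q))%:E)
        (fun n => ((p n)%:R `^ (1 - delta))%:E)) ->
   lesssim
     (fun n => (rate n +
        Num.min (T n) ((T n + Num.sqrt (T n)) / Num.sqrt n%:R))%:E)
     (fun n => minimax_theta n (p n) q cL cU nu (rad n) (tau n))).
Proof.
move=> T r L rate _.
have cU_gt0 : 0 < cU := lt_trans cL_gt0 cL_lt_cU.
pose c1 := (cL + cU) / 2; pose eta := (c1 - cL) / (2 * c1).
have c1_gt0 : 0 < c1 by rewrite divr_gt0 // addr_gt0.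
have eta_gt0 : 0 < eta.
  by apply: divr_gt0; [rewrite /c1; lra|rewrite mulr_gt0].
pose S n := r n * (1 + T n) `^ (- (q / 2)) * L n `^ (- (q / 2)).
have T_gt0 n : (0 < n)%N -> 0 < T n.
  by move=> n0; apply: ttau_gt0; rewrite ?rad_gt0 ?tau_gt0.
have r_gt0 n : (0 < n)%N -> 0 < r n.
  by move=> n0; apply: tR_gt0; rewrite ?rad_gt0 ?tau_gt0 ?p_gt0.
have L_gt0 n : (0 < n)%N -> (1 < p n)%N -> 0 < L n.
  by move=> n0 p1; rewrite divr_gt0 ?ltr0n // ln_gt0 // ltr1n.
have S_gt0 n : (0 < n)%N -> (1 < p n)%N -> 0 < S n.
  move=> n0 p1; rewrite !mulr_gt0 ?powR_gt0 ?r_gt0 ?L_gt0 //.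
  by rewrite addr_gt0 ?T_gt0.
have S_rad n : (0 < n)%N -> (1 < p n)%N ->
    S n * (Num.max 1 (T n) * L n) `^ (q / 2) <= rad n.
  move=> n0 p1; apply: le_trans (tR_le _ _ _ _ _).
  by apply: spike_scale_le; rewrite ?T_gt0 ?L_gt0 ?r_gt0.
have powR_dim (delta : R) n : (0 < n)%N ->
    (p n)%:R `^ (1 - delta) <= (p n)%:R `^ (1 - Num.min delta 1).
  move=> n0; apply: ler_powR; first by rewrite ler1n p_gt0.
  by rewrite lerD2l lerN2 ge_min lexx.
split=> -[delta delta_gt0 [[C1 C1_gt0 H1] [C2 C2_gt0 H2]]].
(* [block_size] needs an exponent of at most 1; lowering [delta] only weakens the upper bound
   because [p n >= 1]. *)
- have d_gt0 : 0 < Num.min delta 1 by rewrite lt_min delta_gt0 ltr01.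
  have d_le1 : Num.min delta 1 <= 1 by rewrite ge_min lexx orbT.
  have [kap kap_gt0 [k1 k2 k3 k4]] := kap_exists cU q_gt0 eta_gt0 c1_gt0 d_gt0.
  (* Shrinking the number of spikes by [y1] absorbs the constant [C2] of the sparsity assumption. *)
  pose y1 := Num.min 1 (2 * C2)^-1.
  have y1_gt0 : 0 < y1 by rewrite lt_min ltr01 invr_gt0 mulr_gt0.
  have y1_le1 : y1 <= 1 by rewrite ge_min lexx.
  have c0 : 0 < kap ^+ 2 * y1 / (64 * c1).
    by apply: divr_gt0; apply: mulr_gt0 => //; exact: exprn_gt0.
  exists (2 / (kap ^+ 2 * y1 / (64 * c1))); first by rewrite divr_gt0.
  move=> n n0; have p1 : (1 < p n)%N.
    apply: dim_gt1 (H1 n n0); first exact: p_gt0.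
    by rewrite oppr_eq0 gt_eqF // divr_gt0.
  have [T_tau T_rad] := ttau_le q cU (rad n) (tau n).
  have yS : y1 * S n <= (p n)%:R `^ (1 - Num.min delta 1) / 2.
    have := H2 n n0; rewrite -EFinM lee_fin -/(S n) => H.
    apply: (@le_trans _ _ ((2 * C2)^-1 * (C2 * (p n)%:R `^ (1 - delta)))).
      apply: ler_pM => //; [exact: ltW|exact: ltW (S_gt0 n n0 p1)|].
      by rewrite ge_min lexx orbT.
    rewrite invfM -mulrA mulKf ?gt_eqF // mulrC ler_pM2r ?invr_gt0 //.
    exact: powR_dim.
  apply: (EFin_scale_le (b := kap ^+ 2 * y1 / (64 * c1) *
    (Num.max 1 (T n) * Num.min (Num.min (T n) 1) (S n * L n)))).
  + by rewrite ltW // divr_gt0.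
  + rewrite mulrA divfK ?gt_eqF //.
    by apply: rate_le; rewrite ?T_gt0 ?L_gt0 ?r_gt0.
  (* Once [p n] is written [P.+1], [p1] also serves as the proof of [0 < P]. *)
  + move: (S_gt0 n n0 p1) (S_rad n n0 p1) yS; rewrite /L.
    case: (p n) p1 => // P p1 S0 SR yS.
    exact: (alpha_rate q_gt0 cL_gt0 cL_lt_cU nu_ge erefl erefl kap_gt0 k1 k2 k4
      p1 n0 (T_gt0 n n0) T_tau (rad_gt0 n n0) T_rad S0 SR y1_gt0 y1_le1 d_gt0 d_le1 k3 yS).
- have d_gt0 : 0 < Num.min delta 1 by rewrite lt_min delta_gt0 ltr01.
  have d_le1 : Num.min delta 1 <= 1 by rewrite ge_min lexx orbT.
  have [kap kap_gt0 [k1 k2 k3 k4]] := kap_exists cU q_gt0 eta_gt0 c1_gt0 d_gt0.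
  (* The sparsity enters squared, and [y1 ^ 2 <= y1] suffices to absorb [C2]. *)
  pose y1 := Num.min 1 (4 * C2)^-1.
  have y1_gt0 : 0 < y1 by rewrite lt_min ltr01 invr_gt0 mulr_gt0.
  have y1_le1 : y1 <= 1 by rewrite ge_min lexx.
  have c0 : 0 < kap ^+ 2 * y1 / 32.
    by apply: divr_gt0 => //; apply: mulr_gt0 => //; exact: exprn_gt0.
  have c0' : 0 < kap ^+ 2 / 16 by rewrite divr_gt0 ?exprn_gt0.
  pose K1 := 2 / (kap ^+ 2 * y1 / 32); pose K2 := 2 / (kap ^+ 2 / 16).
  have K1_gt0 : 0 < K1 by rewrite divr_gt0.
  have K2_gt0 : 0 < K2 by rewrite divr_gt0.
  exists (K1 + K2); first by rewrite addr_gt0.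
  move=> n n0; have p1 : (1 < p n)%N.
    apply: dim_gt1 (H1 n n0); first exact: p_gt0.
    by rewrite oppr_eq0 gt_eqF.
  have [T_tau T_rad] := ttau_le q cU (rad n) (tau n).
  have yS : (y1 * S n) ^+ 2 <= (p n)%:R `^ (1 - Num.min delta 1) / 4.
    have := H2 n n0; rewrite -EFinM lee_fin -(powRN_sqr (1 + T n) q) -(powRN_sqr (L n) q) -!exprMn -/(S n) => H.
    apply: (@le_trans _ _ ((4 * C2)^-1 * (C2 * (p n)%:R `^ (1 - delta)))).
      rewrite exprMn; apply: ler_pM; rewrite ?sqr_ge0 //.
      rewrite expr2; apply: le_trans (ler_piMr (ltW y1_gt0) y1_le1) _.
      by rewrite ge_min lexx orbT.
    rewrite invfM -mulrA mulKf ?gt_eqF // mulrC ler_pM2r ?invr_gt0 //.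
    exact: powR_dim.
  pose b1 := kap ^+ 2 * y1 / 32 *
    (Num.max 1 (T n) * Num.min (Num.min (T n) 1) (S n * L n)).
  pose b2 := kap ^+ 2 / 16 * (Num.max 1 (T n) *
    Num.sqrt (Num.min (T n) 1 * Num.min (Num.min (T n) 1) n%:R^-1)).
  (* The two terms come from different families of hypotheses, so the risk dominates their maximum;
     [K1 + K2] turns the maximum into the sum. *)
  apply: (EFin_scale_le (b := Num.max b1 b2)); first by rewrite addr_ge0 // ltW.
  + rewrite [leRHS]mulrDl; apply: lerD.
      apply: (@le_trans _ _ (K1 * b1)).
        rewrite /K1 /b1 mulrA divfK ?gt_eqF //.
        by apply: rate_le; rewrite ?T_gt0 ?L_gt0 ?r_gt0.
      by apply: ler_wpM2l; [exact: ltW|rewrite le_max lexx].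
    apply: (@le_trans _ _ (K2 * b2)).
      rewrite /K2 /b2 mulrA divfK ?gt_eqF //.
      by apply: param_rate_le; rewrite ?T_gt0.
    by apply: ler_wpM2l; [exact: ltW|rewrite le_max lexx orbT].
  + rewrite EFin_max ge_max; apply/andP; split; rewrite /b1 /b2.
      move: (S_gt0 n n0 p1) (S_rad n n0 p1) yS; rewrite /L.
      case: (p n) p1 => // P p1 S0 SR yS.
      exact: (theta_sparse_rate q_gt0 cL_gt0 cL_lt_cU nu_ge erefl erefl kap_gt0 k1 k2 k4
        p1 n0 (T_gt0 n n0) T_tau (rad_gt0 n n0) T_rad S0 SR y1_gt0 y1_le1 d_gt0 d_le1 k3 yS).
    case: (p n) p1 => // P p1.
    exact: (theta_param_rate q_gt0 cL_gt0 cL_lt_cU nu_ge erefl erefl kap_gt0 k1 k2 k4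
      p1 n0 (T_gt0 n n0) T_tau (rad_gt0 n n0) T_rad).
Qed.
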